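(* Let $q\ge2$ be an integer and let $f\colon\mathbb{N}_0\to\mathbb{U}$ be a $q$-multiplicative sequence of Gelfond type, i.e. there exists $c>0$ with $\sup_{\alpha\in\mathbb{R}}\big|\frac1N\sum_{n=0}^{N-1}f(n)e(n\alpha)\big|\ll N^{-c}$ for $N\ge1$. Then for every real polynomial $p$ with $p(\mathbb{N}_0)\subset\mathbb{N}_0$, every measure-preserving system $(X,\mathcal{B},T,\mu)$ and every $F\in L^r(\mu)$ for some $r>1$, $$\lim_{N\to\infty}\frac1N\sum_{n=0}^{N-1}f(n)F(T^{p(n)}x)=0\quad\text{for $\mu$-almost all }x\in X.$$
   Context: $\mathbb{N}_0=\{0,1,2,\dots\}$, $\mathbb{U}=\{z\in\mathbb{C}:|z|=1\}$, $e(t)=e^{2\pi i t}$. A sequence $f\colon\mathbb{N}_0\to\mathbb{U}$ is $q$-multiplicative if for all integers $t,m,n\ge 0$ with $m<q^t$ and $q^t\mid n$ one has $f(m+n)=f(m)f(n)$. $X\ll Y$ means $|X|\le CY$ for a constant $C$ independent of $N$. *)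

(* Defs.v *)
From HB Require Import structures.
From mathcomp Require Import all_boot all_order all_algebra.
From mathcomp Require Import all_classical all_reals all_analysis.
From mathcomp Require Import complex.
Set Implicit Arguments. Unset Strict Implicit. Unset Printing Implicit Defensive.
Import Order.TTheory GRing.Theory Num.Theory.
Local Open Scope ring_scope.
Local Open Scope complex_scope.
Local Open Scope classical_set_scope.

Definition cabs (R : realType) (z : R[i]) : R :=
  let: a +i* b := z in Num.sqrt (a ^+ 2 + b ^+ 2).

Definition ee (R : realType) (t : R) : R[i] :=
  (cos (2 * pi * t)) +i* (sin (2 * pi * t)).

Definition unimodular (R : realType) (f : nat -> R[i]) : Prop :=
  forall n, cabs (f n) = 1.

Definition q_multiplicative (R : realType) (q : nat) (f : nat -> R[i]) : Prop :=
  forall t m n : nat, (m < q ^ t)%N -> (q ^ t %| n)%N -> f (m + n)%N = f m * f n.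

Definition gelfond_type (R : realType) (f : nat -> R[i]) : Prop :=
  exists c : R, 0 < c /\ exists C : R,
    forall (N : nat) (alpha : R), (1 <= N)%N ->
      cabs ((N%:R)^-1 * \sum_(n < N) f n * ee (n%:R * alpha))
        <= C * (N%:R `^ (- c)).

Definition measure_preserving d (X : measurableType d) (R : realType)
  (mu : probability X R) (T : X -> X) : Prop :=
  measurable_fun setT T /\
  forall A : set X, measurable A -> mu (T @^-1` A) = mu A.

Definition in_Lr d (X : measurableType d) (R : realType)
  (mu : probability X R) (r : R) (F : X -> R[i]) : Prop :=
  measurable_fun setT (fun x => let: a +i* _ := F x in a) /\
  measurable_fun setT (fun x => let: _ +i* b := F x in b) /\
  (\int[mu]_x ((cabs (F x)) `^ r)%:E < +oo)%E.

(* Main.v *)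
Require Import Defs.
From HB Require Import structures.
From mathcomp Require Import all_boot all_order all_algebra.
From mathcomp Require Import all_classical all_reals all_analysis measurable_realfun.
From mathcomp Require Import complex ring lra zify.
Set Implicit Arguments. Unset Strict Implicit. Unset Printing Implicit Defensive.
Import Order.TTheory GRing.Theory Num.Theory.
Import numFieldNormedType.Exports.
Local Open Scope classical_set_scope.
Local Open Scope ring_scope.
Local Notation Re := complex.Re.
Local Notation Im := complex.Im.

(** Write [G x = f (q ^ p * x)].  If [f] is close to a character on the digits
    [j], [j + 1] for most [j < L], then a real number [al] chosen digit by digit
    from the top makes [sum_(n < q ^ L) f n e(n al)] larger than the Gelfond
    condition allows; hence a positive proportion of the [j] are defective.  By
    [q]-multiplicativity a defect at [j] forces a multiplicative difference of
    order [D + 1] of [G] to stay away from 1 near digit [j].  Independent random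
    perturbations placed at these digits, one Cauchy-Schwarz inequality for each
    of [D + 1] copies, and the vanishing of the [(D + 1)]-st differences of a
    polynomial of degree at most [D], give a power saving for
    [sum_(n < N) f n e(P n)], uniformly in [P].

    Fourier analysis on [Z/MZ] along orbits turns this into an [L^2] bound for
    the ergodic averages, and truncation into an [L^1] power saving for functions
    in [L^r].  The averages along [N = k ^ A] are then summable in [L^1].  The
    blocks [k ^ A <= n < (k + 1) ^ A] have relative length [O(1/k)], so, [r] being
    larger than 1, the parts of [F] above [sqrt k] are summable too, and no maximal
    inequality is needed. *)

(** * Complex absolute value and additive characters *)

(** A global shift of [n], as in van der Corput's method, creates carries, and [f] is then out of
    control. The perturbations used here stay inside one block of digits and never carry, so the box
    average of [f] is a product over blocks, and every block with a defect contributes a factor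
    below 1. A function whose differences of order [D + 1] are trivial is a polynomial phase;
    [q]-multiplicativity makes it additive between low and high digits, which leaves only linear
    phases, and these are what the Gelfond condition excludes. This is how a hypothesis on linear
    phases controls all degrees. The bound has to be uniform over real polynomials because the
    Fourier step uses the phases [al * p n] for every frequency [al], and because cutting [[0, N)]
    into blocks translates the polynomial. *)

Section Cabs.
Variable R : realType.
Implicit Types (x y z : R[i]) (a : R).

Lemma cabsM x y : cabs (x * y) = cabs x * cabs y.
Proof. exact: ComplexField.Normc.normcM. Qed.

Lemma cabsD x y : cabs (x + y) <= cabs x + cabs y.
Proof. exact: le_normcD. Qed.

Lemma cabsN x : cabs (- x) = cabs x.
Proof. exact: normcN. Qed.

Lemma cabsV x : cabs x^-1 = (cabs x)^-1.
Proof. exact: ComplexField.Normc.normcV. Qed.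

Lemma cabs0 : cabs (0 : R[i]) = 0.
Proof. exact: ComplexField.Normc.normc0. Qed.

Lemma cabs1 : cabs (1 : R[i]) = 1.
Proof. exact: ComplexField.Normc.normc1. Qed.

Lemma cabsR a : cabs a%:C%C = `|a|.
Proof. by rewrite /cabs/= expr0n addr0 sqrtr_sqr. Qed.

Lemma cabs_ge0 x : 0 <= cabs x.
Proof. by case: x => a b; rewrite sqrtr_ge0. Qed.

Lemma cabs_nat n : cabs (n%:R : R[i]) = n%:R.
Proof. by rewrite -(rmorph_nat (real_complex R)) cabsR ger0_norm. Qed.

Lemma cabsB x y : cabs (x - y) = cabs (y - x).
Proof. by rewrite -cabsN opprB. Qed.

Lemma cabs_conj x : cabs x^*%C = cabs x.
Proof. by case: x => a b; rewrite /cabs/= sqrrN. Qed.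

Lemma mulc_conj x : x * x^*%C = (cabs x ^+ 2)%:C%C.
Proof.
case: x => a b; rewrite /cabs/= sqr_sqrtr ?addr_ge0 ?sqr_ge0//.
by apply/eqP; rewrite eq_complex/= !expr2 mulrN opprK mulrN [b * a]mulrC addNr !eqxx.
Qed.

Lemma cabs_sum (I : Type) (r : seq I) (P : pred I) (F : I -> R[i]) :
  cabs (\sum_(i <- r | P i) F i) <= \sum_(i <- r | P i) cabs (F i).
Proof.
elim/big_ind2: _ => [|x1 x2 y1 y2 h1 h2|i _]; rewrite ?cabs0//.
exact: le_trans (cabsD _ _) (lerD h1 h2).
Qed.

Lemma cabs_distD x y z : cabs (x - z) <= cabs (x - y) + cabs (y - z).
Proof. by rewrite -{1}(subrK y x) -addrA cabsD. Qed.

Lemma cabs_sub x y : cabs x - cabs y <= cabs (x - y).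
Proof. by rewrite lerBlDr -{1}(subrK y x) cabsD. Qed.

Lemma Re_le_cabs x : `|Re x| <= cabs x.
Proof.
case: x => a b /=; rewrite -sqrtr_sqr ler_sqrt ?addr_ge0 ?sqr_ge0//.
by rewrite lerDl sqr_ge0.
Qed.

Lemma Re_add x y : Re (x + y) = Re x + Re y. Proof. by case: x y => ? ? []. Qed.

Lemma Re_sum (I : Type) (r : seq I) (P : pred I) (F : I -> R[i]) :
  Re (\sum_(i <- r | P i) F i) = \sum_(i <- r | P i) Re (F i).
Proof. by elim/big_ind2: _ => // x1 x2 y1 y2 <- <-; rewrite Re_add. Qed.

Lemma Im_add x y : Im (x + y) = Im x + Im y. Proof. by case: x y => ? ? []. Qed.

Lemma Im_sum (I : Type) (r : seq I) (P : pred I) (F : I -> R[i]) :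
  Im (\sum_(i <- r | P i) F i) = \sum_(i <- r | P i) Im (F i).
Proof. by elim/big_ind2: _ => // x1 x2 y1 y2 <- <-; rewrite Im_add. Qed.

Lemma Re_mulR x a : Re (x * a%:C%C) = Re x * a.
Proof. by case: x => u v /=; rewrite mulr0 subr0. Qed.

Lemma Re_mulRl x a : Re (a%:C%C * x) = a * Re x.
Proof. by rewrite mulrC Re_mulR mulrC. Qed.

Lemma Im_mulR x a : Im (x * a%:C%C) = Im x * a.
Proof. by case: x => u v /=; rewrite mulr0 add0r. Qed.

Lemma cabs2E x : cabs x ^+ 2 = Re x ^+ 2 + Im x ^+ 2.
Proof. by case: x => a b; rewrite /cabs/= sqr_sqrtr ?addr_ge0 ?sqr_ge0. Qed.

Lemma conj_unimodr x : cabs x = 1 -> x * x^*%C = 1.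
Proof. by move=> h; rewrite mulc_conj h expr1n. Qed.

Lemma Re_unimod x : cabs x = 1 -> Re x = 1 - cabs (x - 1) ^+ 2 / 2.
Proof.
move=> h; have := cabs2E x; rewrite h cabs2E.
case: x {h} => a b /=; rewrite expr1n; nra.
Qed.

End Cabs.

Section Ee.
Variable R : realType.
Implicit Types s t : R.

Lemma eeD s t : ee (s + t) = ee s * ee t.
Proof.
rewrite /ee; apply/eqP; rewrite eq_complex/= !mulrDr cosD sinD eqxx/=.
by apply/eqP; ring.
Qed.

Lemma ee0 : ee (0 : R) = 1.
Proof. by rewrite /ee mulr0 cos0 sin0. Qed.

Lemma cabs_ee t : cabs (ee t) = 1.
Proof. by rewrite /cabs/ee/= cos2Dsin2 sqrtr1. Qed.

Lemma eeN t : ee (- t) = (ee t)^*%C.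
Proof. by rewrite /ee/= mulrN cosN sinN. Qed.

Lemma eeB s t : ee (s - t) = ee s * (ee t)^*%C.
Proof. by rewrite eeD eeN. Qed.

Lemma ee1 : ee (1 : R) = 1.
Proof. by rewrite /ee mulr1 mulr_natl cos2pi sin2pi. Qed.

Lemma ee_nat n : ee (n%:R : R) = 1.
Proof. by elim: n => [|n IH]; rewrite ?ee0// -addn1 natrD eeD IH ee1 mulr1. Qed.

Lemma ee_int (k : int) : ee (k%:~R : R) = 1.
Proof. by case: k => n; rewrite ?NegzE ?mulrNz ?eeN ee_nat ?conjc1. Qed.

Lemma eeDint t (k : int) : ee (t + k%:~R) = ee t.
Proof. by rewrite eeD ee_int mulr1. Qed.

Lemma eeX t n : ee t ^+ n = ee (n%:R * t).
Proof.
by elim: n => [|n IH]; rewrite ?mul0r ?ee0// exprS IH -eeD -natr1 mulrDl mul1r addrC.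
Qed.

Lemma ee_surj (z : R[i]) : cabs z = 1 -> exists t, z = ee t.
Proof.
case: z => a b h; have := cabs2E (a +i* b)%C; rewrite h expr1n /= => ab.
have a1 : -1 <= a <= 1 by apply/andP; split; nra.
have pi2 : 2 * pi != 0 :> R by rewrite mulf_neq0// gt_eqF// pi_gt0.
have ha : cos (acos a) = a by rewrite acosK.
have hb : sin (acos a) = `|b|.
  by rewrite sin_acos// ab addrC addKr sqrtr_sqr.
have [b0|b0] := leP 0 b.
- by exists (acos a / (2 * pi)); rewrite /ee mulrC divfK// ha hb ger0_norm.
- exists (- acos a / (2 * pi)); rewrite /ee mulrC divfK// cosN sinN ha hb.
  by rewrite ltr0_norm// opprK.
Qed.

Lemma cabs_ee_sub1 t : cabs (ee t - 1) ^+ 2 = 2 - 2 * cos (2 * pi * t).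
Proof.
rewrite cabs2E /ee/=; have := cos2Dsin2 (2 * pi * t); nra.
Qed.

Lemma ee_near1 (e : R) : 0 < e ->
  exists2 d, 0 < d & forall t, `|t| <= d -> cabs (ee t - 1) <= e.
Proof.
move=> e0.
have e20 : 0 < e ^+ 2 / 2 by rewrite divr_gt0// exprn_gt0.
have cc : {for (0 : R), continuous (fun t : R => cos (2 * pi * t))}.
  apply: continuous_comp; last exact: continuous_cos.
  by apply: cvgM; [exact: cvg_cst|exact: cvg_id].
have /cvgrPdist_lt/(_ _ e20) := cc.
rewrite mulr0 cos0 => /nbhs_ballP[d /= d0 hd].
exists (d / 2); first by rewrite divr_gt0.
move=> t td.
have /hd : ball (0 : R) d t.
  rewrite /ball/= sub0r normrN (le_lt_trans td)// ltr_pdivrMr// ltr_pMr//.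
  by rewrite ltr1n.
move=> /ltr_normlW h.
rewrite -(@ler_pXn2r _ 2)// ?nnegrE ?cabs_ge0 ?(ltW e0)// cabs_ee_sub1.
by move: h; rewrite ltr_pdivlMr//; lra.
Qed.

Lemma ee_far1 (k : R) : 0 < k ->
  exists2 d, 0 < d & forall t, (forall n : int, k < `|t - n%:~R|) ->
    d <= cabs (ee t - 1).
Proof.
move=> k0.
have [kh|kh] := leP k (1 / 2); last first.
  (* For [k] above 1/2 the hypothesis on [t] cannot hold, as some integer lies within 1/2 of [t];
     any positive distance serves. *)
  exists 1 => // t /(_ (Num.floor (t + 1 / 2))).
  have := floor_itv (t + 1 / 2); rewrite intrD.
  move=> /andP[h1 h2]; set x := (_%:~R) in h1 h2 *.
  have : `|t - x| <= 1 / 2 by rewrite ler_norml; apply/andP; split; lra.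
  by move=> h3 /lt_le_trans/(_ h3); rewrite ltNge (ltW kh).
have pi0 : 0 < pi :> R := pi_gt0 R.
have kin : (2 * pi * k : R) \in `[0, pi].
  rewrite in_itv/=; apply/andP; split; nra.
have zin : 0 \in `[0, pi : R] by rewrite in_itv/= lexx pi_ge0.
have c1 : cos (2 * pi * k) < 1.
  by rewrite -[ltRHS]cos0 ltr_cos ?mulr_gt0.
(* This is the distance from [ee k] to 1. Reducing [t] modulo 1 to absolute value at most 1/2 puts
   the angle where [cos] decreases. *)
exists (Num.sqrt (2 - 2 * cos (2 * pi * k))).
  by rewrite sqrtr_gt0; lra.
move=> t /(_ (Num.floor (t + 1 / 2))) h.
rewrite -(@ler_pXn2r _ 2)// ?nnegrE ?cabs_ge0 ?sqrtr_ge0//.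
rewrite sqr_sqrtr; last by lra.
set n := Num.floor _ in h *.
have -> : ee t = ee (t - n%:~R) by rewrite eeB ee_int conjc1 mulr1.
rewrite cabs_ee_sub1.
have := floor_itv (t + 1 / 2); rewrite intrD -/n.
move: h; set u := t - _ => h /andP[h1 h2].
have u2 : `|u| <= 1 / 2 by rewrite ler_norml /u; apply/andP; split; lra.
have uin : (2 * pi * `|u| : R) \in `[0, pi].
  rewrite in_itv/=; apply/andP; split; first by rewrite !mulr_ge0// pi_ge0.
  by nra.
rewrite -[cos (2 * pi * u)]cos_norm normrM [`|2 * pi|]ger0_norm; last by nra.
have : cos (2 * pi * `|u|) < cos (2 * pi * k).
  by rewrite ltr_cos//; nra.
by lra.
Qed.

Lemma ee_neq1 t : 0 < `|t| < 1 -> ee t != 1.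
Proof.
move=> /andP[t0 t1]; apply/eqP => /(congr1 (fun z : R[i] => cabs (z - 1) ^+ 2)).
rewrite subrr cabs0 cabs_ee_sub1 expr0n/= -cos_norm normrM [`|2 * pi|]ger0_norm; last first.
  by rewrite mulr_ge0// pi_ge0.
have -> : 2 * pi * `|t| = (pi * `|t|) *+ 2 by rewrite mulr2n; ring.
rewrite cos_mulr2n.
have := cos2Dsin2 (pi * `|t|).
have : 0 < sin (pi * `|t|).
  by rewrite sin_gt0_pi// mulr_gt0 ?pi_gt0//= gtr_pMr// pi_gt0.
rewrite mulr2n; nra.
Qed.

(** Orthogonality of the characters modulo [M]; [i] is an integer so that it may be a difference of
    two residues. *)
Lemma sum_ee_geom (M : nat) (i : int) : (0 < M)%N -> 0 < `|i| -> `|i| < M%:Z ->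
  \sum_(k < M) ee (k%:R * (i%:~R / M%:R) : R) = 0.
Proof.
move=> M0 i0 iM.
have M0' : 0 < M%:R :> R by rewrite ltr0n.
set z := ee (i%:~R / M%:R : R).
have z1 : z != 1.
  apply: ee_neq1; rewrite normrM normfV [`|M%:R|]gtr0_norm// divr_gt0//=.
    rewrite ltr_pdivrMr// mul1r -intr_norm.
    by have := iM; rewrite -(@ltr_int R).
  by rewrite -intr_norm ltr0z.
have zM : z ^+ M = 1 by rewrite /z eeX mulrC divfK ?gt_eqF// ee_int.
have /eqP := subrX1 z M; rewrite zM subrr eq_sym mulf_eq0 subr_eq0 (negbTE z1)/=.
move=> /eqP s0; rewrite -[RHS]s0; by apply: eq_bigr => k _; rewrite /z eeX.
Qed.

End Ee.

(** * Averages and box norms *)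

Section Mean.
Variable R : realType.

(** The variance of [a] under the weights [w] is nonnegative. *)
Lemma sqr_wmean_le (I : finType) (w a : I -> R) : (forall i, 0 <= w i) ->
  \sum_i w i = 1 -> (\sum_i w i * a i) ^+ 2 <= \sum_i w i * a i ^+ 2.
Proof.
move=> w0 w1.
have key m : \sum_i w i * (a i - m) ^+ 2 =
    \sum_i w i * a i ^+ 2 - (2 * m) * (\sum_i w i * a i) + m ^+ 2 * \sum_i w i.
  rewrite !mulr_sumr -sumrB -big_split/=.
  by apply: eq_bigr => i _; ring.
have : 0 <= \sum_i w i * (a i - \sum_j w j * a j) ^+ 2.
  by apply: sumr_ge0 => i _; rewrite mulr_ge0// sqr_ge0.
by rewrite key w1; set m := \sum_i w i * a i; nra.
Qed.

Lemma wmean_exp2_le (I : finType) (w a : I -> R) k : (forall i, 0 <= w i) ->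
  (forall i, 0 <= a i) -> \sum_i w i = 1 ->
  (\sum_i w i * a i) ^+ (2 ^ k) <= \sum_i w i * a i ^+ (2 ^ k).
Proof.
move=> w0 a0 w1; elim: k => [|k IH]; first by rewrite expn0 expr1.
rewrite expnSr exprM.
apply: le_trans (_ : (\sum_i w i * a i ^+ (2 ^ k)) ^+ 2 <= _).
  rewrite ler_pXn2r// nnegrE ?exprn_ge0// sumr_ge0// => i _;
  by rewrite mulr_ge0 ?exprn_ge0.
under [leRHS]eq_bigr do rewrite exprM.
exact: sqr_wmean_le.
Qed.

Definition mean (U : finType) (F : U -> R[i]) : R[i] :=
  (#|U|%:R^-1)%:C%C * \sum_u F u.

(** The weight sits inside the sum, so that [wmean_exp2_le] applies directly. *)
Definition rmean (U : finType) (F : U -> R) : R := \sum_u #|U|%:R^-1 * F u.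

Lemma sum_unif (U : finType) : (0 < #|U|)%N -> \sum_(u : U) (#|U|%:R^-1 : R) = 1.
Proof.
move=> U0; rewrite sumr_const -[LHS]mulr_natr mulVf//.
by rewrite pnatr_eq0 -lt0n.
Qed.

Lemma unif_ge0 (U : finType) : 0 <= (#|U|%:R^-1 : R).
Proof. by rewrite invr_ge0. Qed.

Lemma cabs_mean_le (U : finType) (F : U -> R[i]) :
  cabs (mean F) <= rmean (fun u => cabs (F u)).
Proof.
rewrite /mean /rmean cabsM cabsR ger0_norm ?unif_ge0// -mulr_sumr.
by rewrite ler_wpM2l ?unif_ge0// cabs_sum.
Qed.

Lemma Re_mean (U : finType) (F : U -> R[i]) :
  Re (mean F) = rmean (fun u => Re (F u)).
Proof. by rewrite /mean/rmean Re_mulRl Re_sum mulr_sumr. Qed.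

Lemma le_rmean (U : finType) (F G : U -> R) :
  (forall u, F u <= G u) -> rmean F <= rmean G.
Proof. by move=> h; apply: ler_sum => u _; rewrite ler_wpM2l ?unif_ge0. Qed.

Lemma rmean_ge0 (U : finType) (F : U -> R) :
  (forall u, 0 <= F u) -> 0 <= rmean F.
Proof. by move=> h; apply: sumr_ge0 => u _; rewrite mulr_ge0 ?unif_ge0. Qed.

Lemma rmean_cabs_ge0 (U : finType) (F : U -> R[i]) :
  0 <= rmean (fun u => cabs (F u)).
Proof. by apply: rmean_ge0 => u; exact: cabs_ge0. Qed.

Lemma rmean_exp2_le (U : finType) (F : U -> R) k : (0 < #|U|)%N ->
  (forall u, 0 <= F u) -> rmean F ^+ (2 ^ k) <= rmean (fun u => F u ^+ (2 ^ k)).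
Proof.
by move=> U0 F0; apply: wmean_exp2_le => //; rewrite ?sum_unif// => i; exact: unif_ge0.
Qed.

Lemma meanMr (U : finType) (F : U -> R[i]) c : mean (fun u => F u * c) = mean F * c.
Proof. by rewrite /mean -mulr_suml mulrA. Qed.

Lemma meanMl (U : finType) (F : U -> R[i]) c : mean (fun u => c * F u) = c * mean F.
Proof. by rewrite /mean -mulr_sumr mulrCA. Qed.

Lemma mean_cst (U : finType) (c : R[i]) : (0 < #|U|)%N -> mean (fun _ : U => c) = c.
Proof.
move=> U0; rewrite /mean sumr_const mulrnAr -mulrnAl -(rmorphMn (real_complex R)).
rewrite -mulr_natl mulfV ?mul1r// pnatr_eq0 -lt0n//.
Qed.

Lemma conj_mean (U : finType) (F : U -> R[i]) :
  (mean F)^*%C = mean (fun u => (F u)^*%C).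
Proof. by rewrite /mean rmorphM/= oppr0 rmorph_sum. Qed.

Lemma mean_exchange (U V : finType) (F : U -> V -> R[i]) :
  mean (fun u => mean (F u)) = mean (fun v => mean (F ^~ v)).
Proof.
rewrite /mean -!mulr_sumr !mulrA [_%:C%C * _%:C%C]mulrC; congr (_ * _).
exact: exchange_big.
Qed.

Lemma mean_pair (U V : finType) (F : U * V -> R[i]) :
  mean F = mean (fun u => mean (fun v => F (u, v))).
Proof.
rewrite /mean -mulr_sumr mulrA card_prod natrM invfM rmorphM/=; congr (_ * _).
by rewrite pair_bigA/=; apply: eq_bigr => -[].
Qed.

Lemma eq_mean (U : finType) (F G : U -> R[i]) : F =1 G -> mean F = mean G.
Proof. by move=> h; rewrite /mean (eq_bigr _ (fun u _ => h u)). Qed.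

Lemma mean_sqr_norm (U : finType) (F : U -> R[i]) :
  mean (fun u => mean (fun v => F u * (F v)^*%C)) = (cabs (mean F) ^+ 2)%:C%C.
Proof.
by rewrite -mulc_conj conj_mean -meanMr; apply: eq_mean => u; rewrite meanMl.
Qed.

End Mean.

(** * Box averages, the Gowers-Cauchy-Schwarz inequality, and invariance under polynomial phases *)

Section Box.
Variable R : realType.

(** Lists of length [D] stand for the points of [U^D], which lets the recursion peel off one
    coordinate at a time. *)
Fixpoint avg (U : finType) D (P : seq U -> R[i]) : R[i] :=
  if D is D'.+1 then mean (fun u => avg D' (fun s => P (u :: s))) else P [::].

(** The [2^D]-th power of the Gowers box norm: each coordinate is taken in two independent copies,
    and the values at the [2^D] vertices are multiplied, conjugated according to parity. *)
Fixpoint box (U : finType) D (P : seq U -> R[i]) : R[i] :=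
  if D is D'.+1 then
    mean (fun u => mean (fun v => box D' (fun s => P (u :: s) * (P (v :: s))^*%C)))
  else P [::].

Lemma eq_avg (U : finType) D (P Q : seq U -> R[i]) :
  (forall s, size s = D -> P s = Q s) -> avg D P = avg D Q.
Proof.
elim: D P Q => [|D IH] P Q h /=; first exact: h.
by apply: eq_mean => u; apply: IH => s sD; apply: h; rewrite /= sD.
Qed.

Lemma eq_box (U : finType) D (P Q : seq U -> R[i]) :
  (forall s, size s = D -> P s = Q s) -> box D P = box D Q.
Proof.
elim: D P Q => [|D IH] P Q h /=; first exact: h.
apply: eq_mean => u; apply: eq_mean => v; apply: IH => s sD.
by rewrite !h //= sD.
Qed.

Lemma avgMl (U : finType) D c (P : seq U -> R[i]) :
  avg D (fun s => c * P s) = c * avg D P.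
Proof.
elim: D P => [//|D IH] P /=; rewrite -meanMl; apply: eq_mean => u; exact: IH.
Qed.

Lemma avg_mean (U V : finType) D (P : V -> seq U -> R[i]) :
  avg D (fun s => mean (P ^~ s)) = mean (fun v => avg D (P v)).
Proof.
elim: D P => [//|D IH] P /=; rewrite [RHS]mean_exchange.
by apply: eq_mean => u; rewrite (IH (fun v s => P v (u :: s))).
Qed.

Lemma sqr_avg_le (U : finType) D (P : seq U -> R[i]) : (0 < #|U|)%N ->
  cabs (avg D P) ^+ 2 <= Re (avg D (fun s => P s * (P s)^*%C)).
Proof.
move=> U0; elim: D P => [|D IH] P /=; first by rewrite mulc_conj.
rewrite Re_mean; apply: le_trans (_ : rmean (fun u : U => cabs (avg D (fun s => P (u :: s)))) ^+ 2 <= _).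
  by rewrite ler_pXn2r ?nnegrE ?cabs_ge0 ?rmean_ge0 ?cabs_mean_le// => u; rewrite cabs_ge0.
apply: le_trans (@rmean_exp2_le _ _ _ 1 U0 _) _ => [u|]; first exact: cabs_ge0.
by apply: le_rmean => u; exact: IH.
Qed.

(** Cauchy-Schwarz in the other coordinates replaces the first one by a pair of copies; convexity of
    the remaining power then allows the induction hypothesis for each pair. The induction starts at
    one coordinate, since with none the right-hand side is the real part of an arbitrary number. *)
Lemma avg_le_box (U : finType) D (P : seq U -> R[i]) : (0 < #|U|)%N ->
  cabs (avg D.+1 P) ^+ (2 ^ D.+1) <= Re (box D.+1 P).
Proof.
move=> U0; elim: D P => [|D IH] P.
  by rewrite /= mean_sqr_norm expn1.
rewrite [(2 ^ D.+2)%N]expnS exprM.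
set Q := fun (z : U * U) s => P (z.1 :: s) * (P (z.2 :: s))^*%C.
have UU : (0 < #|{: U * U}|)%N by rewrite card_prod muln_gt0 U0.
apply: le_trans (_ : rmean (fun z => cabs (avg D.+1 (Q z))) ^+ (2 ^ D.+1) <= _).
  rewrite ler_pXn2r ?expn_gt0// ?nnegrE ?sqr_ge0 ?rmean_cabs_ge0//.
  have -> : avg D.+2 P = avg D.+1 (fun s => mean (fun u => P (u :: s))).
    by rewrite (avg_mean D.+1 (fun u s => P (u :: s))).
  apply: (le_trans (sqr_avg_le _ _ U0)).
  rewrite (_ : avg _ _ = mean (fun z => avg D.+1 (Q z))); last first.
    rewrite -(avg_mean D.+1 Q); apply: eq_avg => s _.
    by rewrite mulc_conj -mean_sqr_norm mean_pair.
  rewrite Re_mean; apply: le_rmean => z; exact: (le_trans (ler_norm _) (Re_le_cabs _)).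
apply: le_trans (rmean_exp2_le _ UU _) _ => [u|]; first exact: cabs_ge0.
rewrite (_ : box D.+2 P = mean (fun z => box D.+1 (Q z))); last by rewrite mean_pair.
by rewrite Re_mean; apply: le_rmean => z; exact: IH.
Qed.

Lemma avg_map2 (U V : finType) D (P : seq U -> seq V -> R[i]) :
  avg D (fun s : seq (U * V) => P (map fst s) (map snd s)) =
  avg D (fun s => avg D (P s)).
Proof.
elim: D P => [//|D IH] P /=; rewrite mean_pair; apply: eq_mean => u.
rewrite (avg_mean D (fun v s => avg D (fun s0 => P (u :: s) (v :: s0)))).
by apply: eq_mean => v; rewrite (IH (fun s s0 => P (u :: s) (v :: s0))).
Qed.

(** The copies in [U] and in [V] are independent and the product over the vertices factors; this is
    what turns separate digit blocks into separate factors. *)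
Lemma box_map2 (U V : finType) D (P : seq U -> R[i]) (Q : seq V -> R[i]) :
  box D (fun s : seq (U * V) => P (map fst s) * Q (map snd s)) =
  box D P * box D Q.
Proof.
elim: D P Q => [//|D IH] P Q /=.
rewrite -meanMr mean_pair; apply: eq_mean => u.
transitivity (mean (fun v => mean (fun u' => mean (fun v' =>
   box D (fun s => P (u :: s) * (P (u' :: s))^*%C) *
   box D (fun s => Q (v :: s) * (Q (v' :: s))^*%C))))).
  apply: eq_mean => v; rewrite mean_pair; apply: eq_mean => u'; apply: eq_mean => v'.
  rewrite -IH; apply: eq_box => s _ /=; rewrite rmorphM/=.
  by rewrite !mulrA; congr (_ * _); rewrite mulrAC.
rewrite mean_exchange -meanMr; apply: eq_mean => u'.
by rewrite -meanMl; apply: eq_mean => v; rewrite meanMl.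
Qed.

(** Each monomial gives a difference of [i]-th powers of ['X + a] and ['X + b], which is [a - b]
    times a polynomial of degree below [i]. *)
Lemma size_comp_poly_subXD (P : {poly R}) (a b : R) D : (size P <= D.+1)%N ->
  (size ((P \Po ('X + a%:P)) - (P \Po ('X + b%:P)))%R <= D)%N.
Proof.
move=> sP; rewrite !comp_polyE. rewrite -sumrB.
apply: (big_ind (fun Q : {poly R} => (size Q <= D)%N)).
- by rewrite size_poly0.
- by move=> Q1 Q2 h1 h2; rewrite (leq_trans (size_polyD _ _))// geq_max h1.
move=> [i /= iP] _; rewrite -scalerBr (leq_trans (size_scale_leq _ _))//.
rewrite subrXX opprD addrACA subrr add0r -polyCN -polyCD mul_polyC.
rewrite (leq_trans (size_scale_leq _ _))//.
apply: (big_ind (fun Q : {poly R} => (size Q <= D)%N)).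
- by rewrite size_poly0.
- by move=> Q1 Q2 h1 h2; rewrite (leq_trans (size_polyD _ _))// geq_max h1.
move=> [j /= ji] _.
rewrite (leq_trans (size_polyMleq _ _))//.
have sz c n : size (('X + c%:P : {poly R}) ^+ n) = n.+1.
  by rewrite -[c]opprK polyCN size_exp_XsubC.
rewrite !sz.
by have := leq_trans iP sP; move: ji; clear; lia.
Qed.

(** Doubling a coordinate replaces [P] by a difference of two translates, of smaller degree; after
    [D] doublings the polynomial is zero. *)
Lemma box_mul_phase (U : finType) D (F : seq U -> R[i]) (P : {poly R}) (y : R)
    (v : U -> R) : (size P <= D)%N ->
  box D (fun s => F s * ee P.[y + \sum_(u <- s) v u]) = box D F.
Proof.
elim: D F P y => [|D IH] F P y sP /=.
  by move: sP; rewrite leqn0 size_poly_eq0 => /eqP ->; rewrite horner0 ee0 mulr1.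
apply: eq_mean => u; apply: eq_mean => u'.
rewrite -[RHS](IH _ _ y (size_comp_poly_subXD (v u) (v u') sP)).
apply: eq_box => s _; rewrite !big_cons !(horner_comp, hornerE).
rewrite rmorphM/= mulrACA; congr (_ * _).
by rewrite eeB /=; congr (ee _.[_] * (ee _.[_])^*%C); ring.
Qed.

End Box.

(** * Mixture decompositions of uniform measures *)

Lemma sum_ord_mul (V : nmodType) (a b : nat) (F : nat -> V) :
  \sum_(x < a * b) F x = \sum_(y < b) \sum_(m < a) F (m + a * y)%N.
Proof.
elim: b => [|b IH]; first by rewrite muln0 !big_ord0.
rewrite big_ord_recr /= -IH mulnS addnC -!(big_mkord xpredT F).
rewrite (@big_cat_nat _ _ _ (a * b)) ?leq_addr//=; congr (_ + _).
rewrite -{1}[(a * b)%N]add0n big_addn addKn big_mkord.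
by apply: eq_bigr.
Qed.

Section Decomposition.
Variable R : realType.

Definition mdiff (F : nat -> R[i]) (n : nat) : R[i] := F n.+1 * (F n)^*%C.

Lemma cabs_mdiff F : (forall n, cabs (F n) = 1) -> forall n, cabs (mdiff F n) = 1.
Proof. by move=> h n; rewrite /mdiff cabsM cabs_conj !h mulr1. Qed.

Lemma cabs_iter_mdiff D F : (forall n, cabs (F n) = 1) ->
  forall n, cabs (iter D mdiff F n) = 1.
Proof. by move=> h; elim: D => [//|D IH] /=; exact: cabs_mdiff. Qed.

Lemma mean_bool (F : bool -> R[i]) : mean F = (2^-1)%:C%C * (F true + F false).
Proof. by rewrite /mean big_bool card_bool. Qed.

Lemma box_conj (U : finType) D (P : seq U -> R[i]) :
  box D (fun s => (P s)^*%C) = (box D P)^*%C.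
Proof.
elim: D P => [//|D IH] P /=; rewrite conj_mean; apply: eq_mean => u.
rewrite conj_mean; apply: eq_mean => v; rewrite -IH.
by apply: eq_box => s _; rewrite rmorphM.
Qed.

Lemma box_cst (U : finType) D (z : R[i]) : (0 < #|U|)%N -> cabs z = 1 ->
  box D.+1 (fun _ : seq U => z) = 1.
Proof.
move=> U0; elim: D z => [|D IH] z z1.
  by rewrite /= conj_unimodr// !mean_cst.
rewrite -[RHS](@mean_cst _ U _ U0); apply: eq_mean => u.
rewrite -[RHS](@mean_cst _ U _ U0); apply: eq_mean => v.
by apply: (IH (z * z^*%C)); rewrite conj_unimodr ?cabs1.
Qed.

(** If the two copies of some coordinate coincide, the product over the vertices is 1. With
    probability [2^-(D+1)] all pairs differ, and the product is then the iterated difference at [b]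
    or its conjugate. *)
Lemma box_mdiff D (F : nat -> R[i]) b : (forall n, cabs (F n) = 1) ->
  box D.+1 (fun s : seq bool => F (b + \sum_(u <- s) u)%N) =
  (1 - 2^-1 ^+ D.+1 * (1 - Re (iter D.+1 mdiff F b)))%:C%C.
Proof.
elim: D F b => [|D IH] F b F1.
  rewrite /= !mean_bool !big_seq1 addn0 addn1 !conj_unimodr// /mdiff.
  have -> : F b * (F b.+1)^*%C = (F b.+1 * (F b)^*%C)^*%C.
    by rewrite rmorphM/= conjcK mulrC.
  set z := F b.+1 * _.
  rewrite expr1; case: z => x y; apply/eqP; rewrite eq_complex/=.
  by apply/andP; split; apply/eqP; field.
have bT (G : seq bool -> R[i]) : (forall s, cabs (G s) = 1) ->
    box D.+1 (fun s => G s * (G s)^*%C) = 1.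
  move=> h; rewrite -[RHS](@box_cst bool D 1) ?card_bool ?cabs1//.
  by apply: eq_box => s _; rewrite conj_unimodr.
have h1 : box D.+1 (fun s : seq bool => F (b + \sum_(u <- true :: s) u)%N *
     (F (b + \sum_(u <- false :: s) u)%N)^*%C) =
    box D.+1 (fun s : seq bool => mdiff F (b + \sum_(u <- s) u)%N).
  by apply: eq_box => s _; rewrite !big_cons add0n /mdiff addnA addn1 addSn.
have h2 : box D.+1 (fun s : seq bool => F (b + \sum_(u <- false :: s) u)%N *
     (F (b + \sum_(u <- true :: s) u)%N)^*%C) =
    (box D.+1 (fun s : seq bool => mdiff F (b + \sum_(u <- s) u)%N))^*%C.
  rewrite -h1 -box_conj; apply: eq_box => s _.
  by rewrite rmorphM/= conjcK mulrC.
have -> : box D.+2 (fun s : seq bool => F (b + \sum_(u <- s) u)%N) =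
  mean (fun u => mean (fun v => box D.+1 (fun s : seq bool =>
     F (b + \sum_(u <- u :: s) u)%N * (F (b + \sum_(u <- v :: s) u)%N)^*%C))) by [].
rewrite !mean_bool !bT; [|by move=> s; rewrite F1..].
rewrite h1 h2 IH; last exact: cabs_mdiff.
rewrite conjc_real -iterSr [_ ^+ D.+2]exprS.
apply/eqP; rewrite eq_complex/=.
by apply/andP; split; apply/eqP; field.
Qed.

Fixpoint ravg (U : finType) D (P : seq U -> R) : R :=
  if D is D'.+1 then rmean (fun u => ravg D' (fun s => P (u :: s))) else P [::].

Lemma avg_real (U : finType) D (P : seq U -> R) :
  avg D (fun s => (P s)%:C%C) = (ravg D P)%:C%C.
Proof.
elim: D P => [//|D IH] P /=; rewrite (eq_mean (fun u => IH _)) /mean /rmean.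
by rewrite -mulr_sumr rmorphM/= rmorph_sum.
Qed.

Lemma ravg_le1 (U : finType) D (P : seq U -> R) : (0 < #|U|)%N ->
  (forall s, P s <= 1) -> ravg D P <= 1.
Proof.
move=> U0; elim: D P => [|D IH] P h /=; first exact: h.
apply: le_trans (_ : \sum_(u : U) (#|U|%:R^-1 : R) <= _); last by rewrite sum_unif.
by apply: ler_sum => u _; rewrite ler_piMr ?unif_ge0 ?IH.
Qed.

Lemma avg_sum (U : finType) D (I : finType) (P : I -> seq U -> R[i]) :
  avg D (fun s => \sum_i P i s) = \sum_i avg D (P i).
Proof.
elim: D P => [//|D IH] P /=.
rewrite (eq_mean (fun u => IH (fun i s => P i (u :: s)))).
by rewrite /mean exchange_big/= -mulr_sumr.
Qed.

Lemma avg_cst (U : finType) D (z : R[i]) : (0 < #|U|)%N ->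
  avg D (fun _ : seq U => z) = z.
Proof. by move=> U0; elim: D => [//|D IH] /=; rewrite IH mean_cst. Qed.

(* The uniform law on [0, Q) is written as the mixture over [c], with weights
   [w c], of the laws of [a c + v c u_1 + ... + v c u_D] with [u] uniform; [G] is
   the resulting average of the box norms of [f].  The Cauchy-Schwarz inequality
   is then applied in each component of the mixture. *)
Definition decomp (D Q : nat) (f : nat -> R[i]) (G : R) : Prop :=
  exists (C U : finType) (w : C -> R) (a : C -> nat) (v : C -> U -> nat),
  [/\ (0 < #|U|)%N, (forall c, 0 <= w c) /\ \sum_c w c = 1,
   (forall c s, size s = D -> a c + \sum_(u <- s) v c u < Q)%N,
   (forall phi : nat -> R[i], \sum_(x < Q) phi x =
      Q%:R * \sum_c (w c)%:C%C * avg D (fun s => phi (a c + \sum_(u <- s) v c u)%N))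
   & \sum_c (w c)%:C%C * box D (fun s => f (a c + \sum_(u <- s) v c u)%N) = G%:C%C].

Lemma decomp_trivial D Q f : (0 < Q)%N -> (forall n, cabs (f n) = 1) ->
  decomp D.+1 Q f 1.
Proof.
move=> Q0 f1; exists 'I_Q, unit, (fun=> Q%:R^-1), (@nat_of_ord Q), (fun _ _ => 0%N).
have U0 : (0 < #|{: unit}|)%N by rewrite card_unit.
have wQ : \sum_(c < Q) (Q%:R^-1 : R) = 1.
  by have := @sum_unif R 'I_Q; rewrite card_ord; exact.
have s0 (s : seq unit) : (\sum_(u <- s) 0 = 0)%N by rewrite big1_eq.
split.
- exact: U0.
- by split=> [c|//]; rewrite invr_ge0.
- by move=> c s _; rewrite s0 addn0.
- move=> phi; rewrite mulr_sumr; apply: eq_bigr => c _.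
  rewrite (eq_avg (Q := fun=> phi c)); last by move=> s _; rewrite s0 addn0.
  rewrite avg_cst// mulrA -(rmorph_nat (real_complex R)) -rmorphM/=.
  by rewrite mulfV ?mul1r// pnatr_eq0 -lt0n.
- transitivity (real_complex R (\sum_(c < Q) Q%:R^-1)); last by rewrite wQ.
  rewrite rmorph_sum; apply: eq_bigr => c _.
  rewrite (eq_box (Q := fun=> f c)); last by move=> s _; rewrite s0 addn0.
  by rewrite box_cst ?mulr1.
Qed.

(** The law [lam] of [b] plus [D + 1] fair bits satisfies [lam <= 1], so with weight [1/Q] it fits
    under the uniform law on [[0, Q)]. This is the component [None], the only one with a gain; the
    remainder consists of point masses, whose box value is 1. *)
Lemma decomp_block D Q f b : (b + D.+1 < Q)%N -> (forall n, cabs (f n) = 1) ->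
  decomp D.+1 Q f (1 - Q%:R^-1 * (2^-1 ^+ D.+1 * (1 - Re (iter D.+1 mdiff f b)))).
Proof.
move=> bQ f1.
have Q0 : (0 < Q)%N by exact: leq_ltn_trans bQ.
have QR0 : Q%:R != 0 :> R by rewrite pnatr_eq0 -lt0n.
pose ind (y : nat) (s : seq bool) : R := (b + \sum_(u <- s) u == y)%N%:R.
pose lam (y : nat) := ravg D.+1 (ind y).
have B0 : (0 < #|{: bool}|)%N by rewrite card_bool.
have bs (s : seq bool) : size s = D.+1 -> (b + \sum_(u <- s) u < Q)%N.
  move=> sD; apply: leq_ltn_trans bQ; rewrite leq_add2l -sD.
  elim: s {sD} => [|x s IH]; first by rewrite big_nil.
  by rewrite big_cons /= -add1n leq_add//; case: x.
have s0 (s : seq bool) : (\sum_(u <- s) 0 = 0)%N by rewrite big1_eq.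
have lamP (phi : nat -> R[i]) : \sum_(y < Q) (lam y)%:C%C * phi y =
    avg D.+1 (fun s : seq bool => phi (b + \sum_(u <- s) u)%N).
  transitivity (avg D.+1 (fun s => \sum_(y < Q) phi y * (ind y s)%:C%C)).
    rewrite avg_sum; apply: eq_bigr => y _.
    by rewrite (avgMl D.+1 (phi y)) avg_real mulrC.
  apply: eq_avg => s sD.
  have := bs _ sD; rewrite /ind; set x := (b + _)%N => xQ.
  rewrite (bigD1 (Ordinal xQ))//= eqxx mulr1 big1 ?addr0// => y yb.
  rewrite (_ : (_ == _) = false) ?mulr0//; apply: contra_neqF yb => /eqP yb.
  exact/val_inj/esym.
have lam1 : \sum_(y < Q) lam y = 1.
  apply: (@complexI R); rewrite rmorph_sum/=.
  have := lamP (fun=> 1); rewrite avg_cst// => h; apply: etrans h.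
  by apply: eq_bigr => y _; rewrite mulr1.
pose w (c : option 'I_Q) : R := if c is Some y then Q%:R^-1 * (1 - lam y) else Q%:R^-1.
pose a (c : option 'I_Q) : nat := if c is Some y then y else b.
pose v (c : option 'I_Q) (u : bool) : nat := if c is Some y then 0%N else u.
have sumo (V : nmodType) (F : option 'I_Q -> V) :
    \sum_c F c = F None + \sum_(y < Q) F (Some y).
  rewrite (bigD1 None)//=; congr (_ + _).
  rewrite (reindex_omap Some id) => [|[]]//=.
  by apply: eq_bigl => y; rewrite eqxx.
exists (option 'I_Q), bool, w, a, v; split; first exact: B0.
- split => [[y|]|] /=.
  + rewrite mulr_ge0 ?invr_ge0// subr_ge0 ravg_le1// => s.
    by rewrite /ind; case: eqP.
  + by rewrite invr_ge0.
  + rewrite sumo /= -mulr_sumr sumrB lam1 sumr_const card_ord.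
    by rewrite mulrBr mulr1 -[1 *+ Q]/(Q%:R) mulVf// addrC subrK.
- move=> [y|] s sD; last exact: bs.
  by rewrite /= s0 addn0.
- move=> phi; rewrite sumo.
  have -> : avg D.+1 (fun s => phi (a None + \sum_(u <- s) v None u)%N) =
    \sum_(y < Q) (lam y)%:C%C * phi y by rewrite lamP.
  have QQ : Q%:R * (Q%:R^-1)%:C%C = 1 :> R[i].
    by rewrite -(rmorph_nat (real_complex R)) -rmorphM/= mulfV.
  rewrite mulrDr mulrA -[w None]/(Q%:R^-1) QQ mul1r mulr_sumr.
  rewrite -big_split; apply: eq_bigr => y _.
  rewrite (eq_avg (Q := fun=> phi y)); last by move=> s _; rewrite s0 addn0.
  rewrite avg_cst// -[w (Some y)]/(Q%:R^-1 * (1 - lam y)) rmorphM/= !mulrA QQ mul1r -mulrDl -rmorphD/=.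
  by rewrite addrC subrK mul1r.
- rewrite sumo.
  have -> : box D.+1 (fun s => f (a None + \sum_(u <- s) v None u)%N) =
    (1 - 2^-1 ^+ D.+1 * (1 - Re (iter D.+1 mdiff f b)))%:C%C by rewrite box_mdiff.
  rewrite (eq_bigr (fun y : 'I_Q => (Q%:R^-1 * (1 - lam y))%:C%C)); last first.
    move=> y _; rewrite (eq_box (Q := fun=> f y)); last by move=> s _; rewrite s0 addn0.
    by rewrite box_cst ?mulr1.
  rewrite -rmorph_sum -rmorphM -rmorphD; congr (_%:C)%C.
  rewrite -mulr_sumr sumrB lam1 sumr_const card_ord -[1 *+ Q]/(Q%:R) /w.
  by field.
Qed.

(** A parameter in [U2 * U1] moves the low and the high block independently. The points of the low
    component stay below [Q1], so [f] splits at every vertex and [box_map2] applies. *)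
Lemma decomp_mul D Q1 Q2 f g G1 G2 :
  (forall m x, (m < Q1)%N -> f (m + Q1 * x)%N = f m * g x) ->
  decomp D Q1 f G1 -> decomp D Q2 g G2 -> decomp D (Q1 * Q2) f (G1 * G2).
Proof.
move=> fg [C1 [U1 [w1 [a1 [v1 [U10 [w10 w11] r1 s1 b1]]]]]].
move=> [C2 [U2 [w2 [a2 [v2 [U20 [w20 w21] r2 s2 b2]]]]]].
pose w (c : C1 * C2) := w1 c.1 * w2 c.2.
pose a (c : C1 * C2) := (a1 c.1 + Q1 * a2 c.2)%N.
pose v (c : C1 * C2) (u : U2 * U1) := (v1 c.1 u.2 + Q1 * v2 c.2 u.1)%N.
have av c s : (a c + \sum_(u <- s) v c u =
    (a1 c.1 + \sum_(u <- map snd s) v1 c.1 u) +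
    Q1 * (a2 c.2 + \sum_(u <- map fst s) v2 c.2 u))%N.
  by rewrite /a /v big_split/= -big_distrr/= !big_map mulnDr addnACA.
exists (C1 * C2)%type, (U2 * U1)%type, w, a, v; split.
- by rewrite card_prod muln_gt0 U20.
- split => [c|]; first by rewrite mulr_ge0.
  rewrite -(pair_bigA _ (fun c1 c2 => w1 c1 * w2 c2))/=.
  under eq_bigr do rewrite -mulr_sumr w21 mulr1.
  exact: w11.
- move=> c s sD; rewrite av.
  have h1 := r1 c.1 (map snd s); have h2 := r2 c.2 (map fst s).
  rewrite !size_map in h1 h2; move: (h1 sD) (h2 sD); clear.
  set x := (_ + _)%N; set y := (_ + _)%N => xQ yQ.
  rewrite (@leq_trans (Q1 * y.+1)%N)// ?leq_mul2l ?yQ ?orbT//.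
  by rewrite mulnS ltn_add2r.
- move=> phi; rewrite sum_ord_mul.
  rewrite (s2 (fun y => \sum_(m < Q1) phi (m + Q1 * y)%N)) natrM [Q1%:R * _]mulrC.
  rewrite -[RHS]mulrA; congr (_ * _).
  pose A c1 c2 := avg D (fun s2 => avg D (fun s1 =>
    phi ((a1 c1 + \sum_(u <- s1) v1 c1 u) + Q1 * (a2 c2 + \sum_(u <- s2) v2 c2 u))%N)).
  transitivity (\sum_c2 (w2 c2)%:C%C * (Q1%:R * \sum_c1 (w1 c1)%:C%C * A c1 c2)).
    apply: eq_bigr => c2 _; congr (_ * _).
    rewrite mulr_sumr; under [RHS]eq_bigr do rewrite mulrA -avgMl.
    rewrite -avg_sum; apply: eq_avg => s _.
    rewrite (s1 (fun m => phi (m + Q1 * (a2 c2 + \sum_(u <- s) v2 c2 u))%N)).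
    by rewrite mulr_sumr; apply: eq_bigr => c1 _; rewrite mulrA.
  rewrite mulr_sumr; transitivity (\sum_c1 \sum_c2 Q1%:R * ((w (c1, c2))%:C%C * A c1 c2)).
    rewrite exchange_big/=; apply: eq_bigr => c2 _.
    rewrite mulrCA mulr_sumr !mulr_sumr; apply: eq_bigr => c1 _.
    by rewrite /w/= rmorphM/=; ring.
  rewrite pair_bigA/=; apply: eq_bigr => -[c1 c2] _; congr (_ * (_ * _)).
  rewrite /A -(avg_map2 D (fun s2 s1 =>
    phi ((a1 c1 + \sum_(u <- s1) v1 c1 u) + Q1 * (a2 c2 + \sum_(u <- s2) v2 c2 u))%N)).
  by apply: eq_avg => s _; rewrite av.
- rewrite rmorphM/= -b1 -b2 mulr_suml; under [RHS]eq_bigr do rewrite mulr_sumr.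
  rewrite pair_bigA/=; apply: eq_bigr => -[c1 c2] _ /=.
  rewrite [RHS]mulrACA -rmorphM/= [box D _ * box D _]mulrC -box_map2; congr (_ * _).
  apply: eq_box => s sD; by rewrite av fg/= 1?mulrC// r1// size_map.
Qed.

End Decomposition.

(** * Sums twisted by polynomial phases *)

Section PolynomialPhases.
Variable R : realType.

Lemma decomp_phase D Q (f : nat -> R[i]) G (P : {poly R}) :
  decomp D.+1 Q f G -> (size P <= D.+1)%N ->
  cabs (\sum_(x < Q) f x * ee P.[x%:R]) ^+ (2 ^ D.+1) <= Q%:R ^+ (2 ^ D.+1) * G.
Proof.
move=> [C [U [w [a [v [U0 [w0 w1] r1 s1 b1]]]]]] sP.
rewrite (s1 (fun x => f x * ee P.[x%:R])) cabsM cabs_nat exprMn.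
rewrite ler_wpM2l ?exprn_ge0//.
pose F c s := f (a c + \sum_(u <- s) v c u)%N *
  ee P.[(a c)%:R + \sum_(u <- s) (v c u)%:R].
have FE c s : f (a c + \sum_(u <- s) v c u)%N *
    ee P.[(a c + \sum_(u <- s) v c u)%:R] = F c s.
  by rewrite /F natrD natr_sum.
apply: le_trans (_ : (\sum_c w c * cabs (avg D.+1 (F c))) ^+ (2 ^ D.+1) <= _).
  rewrite ler_pXn2r ?expn_gt0// ?nnegrE ?cabs_ge0//.
  - apply: le_trans (cabs_sum _ _ _) _; apply: ler_sum => c _.
    rewrite cabsM cabsR ger0_norm// (eq_avg (Q := F c))// => s _; exact: FE.
  - by apply: sumr_ge0 => c _; rewrite mulr_ge0 ?cabs_ge0.
apply: (le_trans (wmean_exp2_le D.+1 w0 (fun c => cabs_ge0 _) w1)).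
rewrite -[leRHS]/(Re G%:C%C) -b1 Re_sum; apply: ler_sum => c _.
rewrite Re_mulRl ler_wpM2l//.
apply: (le_trans (avg_le_box _ _ U0)).
rewrite le_eqVlt; apply/orP; left; apply/eqP; congr Re.
exact: (box_mul_phase (fun s => f (a c + \sum_(u <- s) v c u)%N) (a c)%:R
  (fun u => (v c u)%:R) sP).
Qed.

Variables (q : nat) (f : nat -> R[i]).
Hypotheses (q1 : (1 < q)%N) (f1 : unimodular f) (fM : q_multiplicative q f).

Definition fshift p (n : nat) : R[i] := f (q ^ p * n).

Lemma cabs_fshift p n : cabs (fshift p n) = 1.
Proof. exact: f1. Qed.

Lemma fshiftD p s m x : (m < q ^ s)%N ->
  fshift p (m + q ^ s * x) = fshift p m * fshift (p + s) x.
Proof.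
move=> ms; rewrite /fshift mulnDr mulnA -expnD (fM (t := p + s)) ?dvdn_mulr//.
by rewrite expnD ltn_pmul2l// expn_gt0 (ltnW q1).
Qed.

(** The points [b, ..., b + D + 1] entering the difference have to stay in one block of [s] digits.
    The value is a boolean so that hits can be counted by a sum. *)
Definition hit D s (del : R) p : bool :=
  [exists b : 'I_(q ^ s), (b + D.+1 < q ^ s)%N &&
     (del <= cabs (iter D.+1 (@mdiff R) (fshift p) b - 1))].

(** Bounds the value in [decomp_block] when [|z - 1| >= del], since [1 - Re z = |z - 1|^2 / 2] on
    the unit circle. *)
Definition gain D s (del : R) : R :=
  1 - (q ^ s)%:R^-1 * (2^-1 ^+ D.+1 * (del ^+ 2 / 2)).

Lemma decomp_hit D s del p : 0 <= del -> hit D s del p ->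
  exists G, decomp D.+1 (q ^ s) (fshift p) G /\ 0 <= G <= gain D s del.
Proof.
move=> d0 /existsP[b /andP[bs hb]]; eexists; split.
  exact: (decomp_block bs (cabs_fshift p)).
have z1 := cabs_iter_mdiff D.+1 (cabs_fshift p) b.
set z := iter _ _ _ _ in hb z1 *.
have A0 : 0 <= (q ^ s)%:R^-1 :> R by rewrite invr_ge0.
have A1 : (q ^ s)%:R^-1 <= 1 :> R.
  by rewrite invf_le1 ?ltr0n ?expn_gt0 ?(ltnW q1)// ler1n expn_gt0 (ltnW q1).
have B0 : 0 <= 2^-1 ^+ D.+1 :> R by rewrite exprn_ge0.
have B1 : 2^-1 ^+ D.+1 <= 2^-1 :> R.
  by rewrite exprS ler_piMr// exprn_ile1// invf_le1// ler1n.
have zR : -1 <= Re z <= 1 by rewrite -ler_norml -z1 Re_le_cabs.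
apply/andP; split; last first.
  rewrite /gain lerD2l lerN2 ler_wpM2l// ler_wpM2l// (Re_unimod z1).
  have : del ^+ 2 <= cabs (z - 1) ^+ 2 by rewrite ler_pXn2r ?nnegrE ?cabs_ge0.
  lra.
rewrite subr_ge0 mulr_ile1 ?mulr_ge0 ?subr_ge0//; first by case/andP: zR.
move: B0 B1 zR => /=; set B := 2^-1 ^+ _ => B0 B1 /andP[zR zR']; nra.
Qed.

(** A greedy scan upwards from digit [p]: at a hit a block of [s] digits is used and gains a factor,
    otherwise a single digit is passed over with factor 1. A used block covers at most [s] hits, and
    fewer than [s] digits remain at the end, whence [k + 1]. *)
Lemma decomp_hits D s del n p : (0 < s)%N -> 0 <= del ->
  exists G k, [/\ decomp D.+1 (q ^ n) (fshift p) G,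
    0 <= G <= gain D s del ^+ k & (\sum_(i < n) hit D s del (p + i) <= s * k.+1)%N].
Proof.
move=> s0 d0; have [m] := ubnP n; elim: m n p => // m IH n p nm.
have triv r : decomp D.+1 (q ^ r) (fshift p) 1.
  by apply: decomp_trivial; rewrite ?expn_gt0 ?(ltnW q1)//; exact: cabs_fshift.
have cnt r x : (\sum_(i < r) hit D s del (x + i) <= r)%N.
  rewrite -[leqRHS]muln1 -[X in (X * 1)%N]card_ord -sum_nat_const.
  by apply: leq_sum => i _; case: hit.
have [ns|sn] := ltnP n s.
  exists 1, 0%N; rewrite expr0 muln1 lexx ler01; split => //.
  exact: leq_trans (cnt _ _) (ltnW ns).
have comb r G0 : (0 < r <= n)%N -> decomp D.+1 (q ^ r) (fshift p) G0 ->
    exists G k, [/\ decomp D.+1 (q ^ n) (fshift p) (G0 * G), 0 <= G <= gain D s del ^+ k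
     & (\sum_(i < n - r) hit D s del (p + r + i) <= s * k.+1)%N].
  move=> /andP[r0 rn] dG0; have [|G [k [dG Gk ck]]] := IH (n - r)%N (p + r)%N.
    by rewrite ltn_subLR//; apply: leq_trans nm _; rewrite -addn1 addnC leq_add2r.
  exists G, k; split => //.
  rewrite -(subnKC rn) expnD; apply: decomp_mul dG0 dG => x y xr.
  exact: fshiftD.
have cntS r : (r <= n)%N -> (\sum_(i < n) hit D s del (p + i) =
    \sum_(i < r) hit D s del (p + i) + \sum_(i < n - r) hit D s del (p + r + i))%N.
  move=> rn; move: (subnKC rn); move: (n - r)%N => x <-; rewrite big_split_ord/=; congr (_ + _)%N.
  by apply: eq_bigr => i _; rewrite addnA.
have [hp|hp] := boolP (hit D s del p).
- have [G0 [dG0 /andP[G00 G01]]] := decomp_hit d0 hp.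
  have [|G [k [dG /andP[G0' Gk] ck]]] := comb s G0 _ dG0; first by rewrite s0.
  exists (G0 * G), k.+1; split => //.
    by rewrite mulr_ge0//= exprS ler_pM.
  by rewrite (cntS s)// mulnS leq_add.
- have [|G [k [dG Gk ck]]] := comb 1%N 1 _ (triv 1%N); first exact: leq_trans s0 sn.
  exists G, k; split => //; first by rewrite -[G]mul1r.
  rewrite (cntS 1%N) ?(leq_trans s0)// big_ord1 addn0 (negbTE hp).
  exact: ck.
Qed.

End PolynomialPhases.

(** * Multiplicative differences and linear phases *)

Section MultiplicativeDifferences.
Variable R : realType.
Implicit Types F H : nat -> R[i].

Lemma iter_mdiffM k F H x :
  iter k (@mdiff R) (fun m => F m * H m) x = iter k (@mdiff R) F x * iter k (@mdiff R) H x.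
Proof.
elim: k x => [//|k IH] x; rewrite !iterS /mdiff !IH rmorphM/=.
by rewrite mulrACA.
Qed.

Lemma iter_mdiff_conj k F x :
  iter k (@mdiff R) (fun m => (F m)^*%C) x = (iter k (@mdiff R) F x)^*%C.
Proof. by elim: k x => [//|k IH] x; rewrite !iterS /mdiff !IH rmorphM. Qed.

Lemma iter_mdiff_shift k F c x :
  iter k (@mdiff R) (fun m => F (m + c)%N) x = iter k (@mdiff R) F (x + c)%N.
Proof. by elim: k x => [//|k IH] x; rewrite !iterS /mdiff !IH. Qed.

Lemma iter_mdiff_cst k (z : R[i]) x : cabs z = 1 ->
  iter k.+1 (@mdiff R) (fun=> z) x = 1.
Proof.
move=> z1; elim: k x => [|k IH] x; first by rewrite /= /mdiff conj_unimodr.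
by rewrite iterS /mdiff !IH mul1r conjc1.
Qed.

(** All factors of the iterated difference except the one at [x + k] come from values equal to 1. *)
Lemma iter_mdiff_top k F x : (forall i, (i < k)%N -> F (x + i)%N = 1) ->
  iter k (@mdiff R) F x = F (x + k)%N.
Proof.
elim: k F => [|k IH] F h; first by rewrite addn0.
rewrite iterSr IH.
  by rewrite /mdiff h// conjc1 mulr1 addnS.
by move=> i ik; rewrite /mdiff -addnS !h ?conjc1 ?mulr1// ltnW.
Qed.

Lemma cabs_conj_sub1 (A B : R[i]) : cabs A = 1 -> cabs B = 1 ->
  cabs (A * B^*%C - 1) = cabs (A - B).
Proof.
move=> A1 B1; rewrite -[in LHS](conj_unimodr B1) -mulrBl cabsM cabs_conj B1.
by rewrite mulr1.
Qed.

Variables (q : nat) (f : nat -> R[i]).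
Hypotheses (q1 : (1 < q)%N) (f1 : unimodular f) (fM : q_multiplicative q f).

Lemma qmult0 : f 0%N = 1.
Proof.
have := fM (t := 0) (m := 0) (n := 0); rewrite expn0 => /(_ isT isT).
move=> h; have : f 0%N * (f 0%N - 1) = 0 by rewrite mulrBr -h mulr1 subrr.
move/eqP; rewrite mulf_eq0 subr_eq0 => /orP[/eqP h0|/eqP//].
by have := f1 0%N; rewrite h0 cabs0 => /eqP; rewrite eq_sym oner_eq0.
Qed.

(* As [G (m + tau n) = G m G (tau n)] for [m < tau], the last value of the
   function [m |-> G (m + tau n) / (G m G (tau n))] on [0, tau] is a
   multiplicative difference of order [D + 1 <= tau]. *)
Lemma fshift_step D t del p n : (D < q ^ t)%N -> (n < q)%N ->
  ~~ hit q f D t.+2 del p ->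
  cabs (fshift q f p (q ^ t * n.+1) -
        fshift q f p (q ^ t) * fshift q f p (q ^ t * n)) <= 2 * del.
Proof.
move=> Dt nq; rewrite negb_exists => /forallP nh.
set G := fshift q f p; set tau := (q ^ t)%N.
have q0 : (0 < q)%N := ltnW q1.
(* The [t + 2] digits of the block leave room for all points up to and including
   [q * tau = q ^ (t + 1)]. *)
have small b : (b + D.+1 <= q * tau)%N -> cabs (iter D.+1 (@mdiff R) G b - 1) <= del.
  move=> bq; have b2 : (b + D.+1 < q ^ t.+2)%N.
    by rewrite (leq_ltn_trans bq)// /tau -expnS ltn_exp2l.
  have b1 : (b < q ^ t.+2)%N by rewrite (leq_ltn_trans _ b2)// leq_addr.
  by have := nh (Ordinal b1); rewrite /= b2/= -ltNge => /ltW.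
pose H m := G (m + tau * n)%N * (G m)^*%C * (G (tau * n)%N)^*%C.
have G1 m : cabs (G m) = 1 by exact: cabs_fshift.
have Hlow m : (m < tau)%N -> H m = 1.
  move=> mt; rewrite /H /G fshiftD//.
  rewrite (_ : fshift q f p (tau * n) = fshift q f (p + t) n); last first.
    by rewrite /fshift mulnA -expnD.
  by rewrite -mulrA mulrACA !conj_unimodr ?mulr1//; exact: cabs_fshift.
have Htau : iter D.+1 (@mdiff R) H (tau - D.+1)%N = H tau.
  rewrite iter_mdiff_top ?subnK// => i iD; apply: Hlow.
  by rewrite -[ltnRHS](subnK Dt) ltn_add2l.
have HD x : iter D.+1 (@mdiff R) H x =
    iter D.+1 (@mdiff R) G (x + tau * n)%N * (iter D.+1 (@mdiff R) G x)^*%C.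
  rewrite iter_mdiffM iter_mdiff_cst ?cabs_conj// mulr1 iter_mdiffM.
  by rewrite iter_mdiff_conj iter_mdiff_shift.
have -> : cabs (G (tau * n.+1)%N - G tau * G (tau * n)%N) = cabs (H tau - 1).
  rewrite /H -mulrA -rmorphM cabs_conj_sub1 ?cabsM ?G1 ?mulr1//.
  by rewrite mulnS.
rewrite -Htau HD cabs_conj_sub1; [|exact: cabs_iter_mdiff..].
(* The two differences of [G], at [tau - (D + 1)] and at its translate by [tau * n], are each within
   [del] of 1. *)
rewrite (le_trans (cabs_distD _ 1 _))// [X in _ + X]cabsB [2 * _]mulr_natl mulr2n.
have taut : (tau <= q * tau)%N by rewrite leq_pmull.
rewrite lerD// small//.
  by rewrite -addnA addnCA subnK// addnC -mulnS mulnC leq_mul2r nq orbT.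
by rewrite subnK.
Qed.

(** Repeats [fshift_step] [m] times. The case [m = q] links digit [p + t] to the next one. *)
Lemma fshift_pow D t del p m : (D < q ^ t)%N -> (m <= q)%N -> 0 <= del ->
  ~~ hit q f D t.+2 del p ->
  cabs (f (q ^ (p + t) * m)%N - f (q ^ (p + t))%N ^+ m) <= 2 * del * q%:R.
Proof.
move=> Dt mq d0 nh.
have fE x : f (q ^ (p + t) * x)%N = fshift q f p (q ^ t * x) by rewrite /fshift mulnA expnD.
have fE1 : f (q ^ (p + t))%N = fshift q f p (q ^ t) by rewrite -[X in f X]muln1 fE muln1.
apply: le_trans (_ : 2 * del * m%:R <= _); last by rewrite ler_wpM2l ?mulr_ge0 ?ler_nat.
elim: m mq => [_|m IH mq].
  by rewrite muln0 expr0 mulr0 qmult0 subrr cabs0.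
rewrite fE fE1 exprS.
apply: le_trans (cabs_distD _ (fshift q f p (q ^ t) * fshift q f p (q ^ t * m)) _) _.
rewrite -mulrBr cabsM cabs_fshift// mul1r -[m.+1%:R]natr1 mulrDr mulr1 addrC lerD//.
  by rewrite -fE -fE1 IH// ltnW.
exact: fshift_step nh.
Qed.

End MultiplicativeDifferences.

Section LinearPhases.
Variables (R : realType) (q : nat) (f : nat -> R[i]).
Hypotheses (q1 : (1 < q)%N) (f1 : unimodular f) (fM : q_multiplicative q f).

Definition digit_sum j (al : R) : R[i] := \sum_(x < q) fshift q f j x * ee (x%:R * al).

Definition block_sum j n (al : R) : R[i] :=
  \sum_(x < q ^ n) fshift q f j x * ee (x%:R * al).

(** Splitting off the lowest digit multiplies the frequency of the others by [q]. A frequency can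
    thus be built from the top, choosing at each digit one of [q] preimages modulo 1. *)
Lemma block_sumS j n al :
  block_sum j n.+1 al = digit_sum j al * block_sum j.+1 n (q%:R * al).
Proof.
rewrite /block_sum expnS (sum_ord_mul q (q ^ n) (fun x => fshift q f j x * ee (x%:R * al))).
rewrite mulr_sumr; apply: eq_bigr => y _; rewrite mulr_suml; apply: eq_bigr => m _.
have -> : fshift q f j (m + q * y) = fshift q f j m * fshift q f j.+1 y.
  have := @fshiftD _ q f q1 fM j 1 m y; rewrite expn1 addn1; exact.
rewrite natrD natrM mulrDl eeD; rewrite -!mulrA; congr (_ * _).
by rewrite mulrCA; congr (_ * (_ * ee _)); ring.
Qed.

Lemma ee_natM_int n al (k : int) : ee (n%:R * (al + k%:~R)) = ee (n%:R * al :> R).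
Proof.
rewrite mulrDr (_ : n%:R * k%:~R = ((n%:Z * k)%:~R)) ?eeDint//.
by rewrite intrM.
Qed.

Lemma digit_sum_int j al (k : int) : digit_sum j (al + k%:~R) = digit_sum j al.
Proof. by apply: eq_bigr => x _; rewrite ee_natM_int. Qed.

Lemma block_sum_int j n al (k : int) : block_sum j n (al + k%:~R) = block_sum j n al.
Proof. by apply: eq_bigr => x _; rewrite ee_natM_int. Qed.

(** By orthogonality the sum over the [q] preimages of [be] keeps only [x = 0] and equals [q], so
    its terms cannot all be below 1 in modulus. *)
Lemma digit_sum_large j be : exists i : nat, 1 <= cabs (digit_sum j ((be + i%:R) / q%:R)).
Proof.
have q0 : (0 < q)%N := ltnW q1.
have qR : q%:R != 0 :> R by rewrite pnatr_eq0 -lt0n.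
apply: contrapT => /forallNP h.
have : cabs (\sum_(i < q) digit_sum j ((be + i%:R) / q%:R)) < q%:R.
  apply: le_lt_trans (cabs_sum _ _ _) _.
  apply: (@lt_le_trans _ _ (\sum_(i < q) 1)); last by rewrite sumr_const card_ord.
  apply: ltr_sum => [|i _]; last by rewrite ltNge; apply/negP; exact: h.
  by apply/hasP; exists (Ordinal q0); rewrite ?mem_index_enum.
rewrite exchange_big/= (bigD1 (Ordinal q0))//= [X in _ + X]big1 ?addr0 => [|x x0].
  under eq_bigr do rewrite mul0r ee0 mulr1 /fshift muln0 (qmult0 f1 fM).
  by rewrite sumr_const card_ord cabs_nat ltxx.
rewrite -mulr_sumr.
under eq_bigr => i _.
  rewrite (_ : x%:R * ((be + i%:R) / q%:R) = x%:R * (be / q%:R) + i%:R * (x%:Z%:~R / q%:R)); last first.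
    by rewrite -pmulrn; field.
  rewrite eeD; over.
rewrite -mulr_sumr sum_ee_geom ?mulr0//.
by rewrite normr_gt0; move: x0; rewrite -val_eqE/=; lia.
by rewrite /=; have := ltn_ord x; lia.
Qed.

(** The factor [c] centres the phases; the angles then stay within [pi / 2 - Y], where [cos] has a
    positive lower bound. The radius is that reached after a bad digit: an angle of 1/2 plus two
    errors [kap <= 1 / (8 q)], divided by [q]. *)
Lemma dirichlet_large : exists2 r0 : R, 0 < r0 <= 1 &
  forall x, `|x| <= (1 / 2 + 1 / (4 * q%:R)) / q%:R ->
    q%:R * r0 <= cabs (\sum_(i < q) ee (i%:R * x)).
Proof.
have q0 : (0 < q)%N := ltnW q1.
have q2 : 2 <= q%:R :> R by rewrite ler_nat.
have qR0 : 0 < q%:R :> R by rewrite ltr0n.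
have pi0 : 0 < pi :> R := pi_gt0 R.
pose Y : R := pi / (4 * q%:R).
have Y0 : 0 < Y by rewrite divr_gt0// mulr_gt0.
have Y2 : Y <= pi / 8 by rewrite /Y ler_pdivrMr ?mulr_gt0//; nra.
have cY : 0 < cos (pi / 2 - Y).
  by rewrite cos_gt0_pihalf//; apply/andP; split; lra.
exists (cos (pi / 2 - Y)); first by rewrite cY cos_le1.
move=> x hx.
pose c := ee (- ((q%:R - 1) / 2 * x)).
apply: le_trans (_ : cabs (c * \sum_(i < q) ee (i%:R * x)) <= _); last first.
  by rewrite cabsM cabs_ee mul1r.
apply: le_trans (_ : Re (c * \sum_(i < q) ee (i%:R * x)) <= _); last first.
  exact: le_trans (ler_norm _) (Re_le_cabs _).
rewrite mulr_sumr Re_sum mulr_natl -[X in _ *+ X](card_ord q) -sumr_const.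
apply: ler_sum => i _; rewrite -eeD /ee/=.
set z := 2 * pi * _.
have i0 : 0 <= i%:R :> R by [].
have iq : i%:R + 1 <= q%:R :> R by rewrite natr1 ler_nat.
have zE : z = 2 * pi * x * (i%:R - (q%:R - 1) / 2) by rewrite /z; ring.
have zle : `|z| <= pi / 2 - Y.
  rewrite zE !normrM gtr0_norm// [`|pi|]gtr0_norm//.
  have h1 : `|i%:R - (q%:R - 1) / 2| <= (q%:R - 1) / 2 :> R.
    by rewrite ler_norml; apply/andP; split; lra.
  have h2 : `|x| * `|i%:R - (q%:R - 1) / 2| <=
      (1 / 2 + 1 / (4 * q%:R)) / q%:R * ((q%:R - 1) / 2) by exact: ler_pM.
  have h3 : (1 / 2 + 1 / (4 * q%:R)) / q%:R * ((q%:R - 1) / 2) <=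
      1 / 4 - 1 / (8 * q%:R) :> R.
    rewrite -subr_ge0.
    have -> : 1 / 4 - 1 / (8 * q%:R) -
       (1 / 2 + 1 / (4 * q%:R)) / q%:R * ((q%:R - 1) / 2) = 1 / (8 * q%:R ^+ 2) :> R.
      by field; rewrite gt_eqF.
    by rewrite divr_ge0// mulr_ge0// exprn_ge0// ltW.
  have -> : pi / 2 - Y = 2 * pi * (1 / 4 - 1 / (8 * q%:R)).
    by rewrite /Y; field; rewrite gt_eqF.
  by rewrite -mulrA ler_pM2l ?mulr_gt0// (le_trans h2).
have := zle; rewrite le_eqVlt => /orP[/eqP zz|zlt].
  by rewrite -zz cos_norm.
rewrite -[leRHS]cos_norm ltW// ltr_cos// in_itv/=; apply/andP; split => //; lra.
Qed.

End LinearPhases.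

(** * A positive proportion of bad digits from the Gelfond condition *)

Section Counting.
Variables (R : realType) (q : nat) (f : nat -> R[i]).
Hypotheses (q1 : (1 < q)%N) (f1 : unimodular f) (fM : q_multiplicative q f).
(* In the applications [f (q ^ j) = ee (th j)]. *)
Variable th : nat -> R.

(** The integer [k] is there because the angles [th] matter only modulo 1; the first clause makes
    the characters at digits [j] and [j + 1] compatible. *)
Definition near_linear (kap : R) (j : nat) : Prop :=
  (exists k : int, `|th j.+1 - q%:R * th j - k%:~R| <= kap) /\
  forall x, (x < q)%N -> cabs (fshift q f j x - ee (x%:R * th j)) <= kap.

Lemma digit_sum_near kap j al : near_linear kap j ->
  cabs (\sum_(x < q) ee (x%:R * (al + th j))) - q%:R * kap <= cabs (digit_sum q f j al).
Proof.
move=> [_ h]; rewrite lerBlDr -lerBlDl.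
apply: le_trans (cabs_sub _ _) _; rewrite /digit_sum -sumrB.
apply: le_trans (cabs_sum _ _ _) _.
rewrite mulr_natl -[X in _ *+ X](card_ord q) -sumr_const; apply: ler_sum => x _.
have -> : ee (x%:R * (al + th j)) = ee (x%:R * th j) * ee (x%:R * al).
  by rewrite -eeD; congr ee; ring.
by rewrite -mulrBl cabsM cabs_ee mulr1 cabsB h.
Qed.

(** Without information on the digit, [digit_sum_large] still provides a preimage with digit sum at
    least 1 in modulus, and an integer translation brings the angle to at most 1/2. *)
Lemma block_sum_step_bad j n be : exists al, `|al + th j| <= 1 / 2 /\
  cabs (block_sum q f j.+1 n be) <= cabs (block_sum q f j n.+1 al).
Proof.
have qR : q%:R != 0 :> R by rewrite pnatr_eq0 -lt0n ltnW.
have [i hi] := digit_sum_large q1 f1 fM j be.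
set a0 := (be + i%:R) / q%:R in hi.
pose k : int := Num.floor (a0 + th j + 1 / 2).
exists (a0 + (- k)%:~R); split.
  have := floor_itv (a0 + th j + 1 / 2); rewrite -/k intrD mulrNz => /andP[h1 h2].
  by rewrite ler_norml; apply/andP; split; lra.
rewrite block_sumS// digit_sum_int.
rewrite mulrDr (_ : q%:R * (- k)%:~R = (q%:Z * - k)%:~R); last by rewrite intrM.
rewrite block_sum_int /a0 [q%:R * _]mulrC divfK// -[i%:R]/(i%:Z%:~R) block_sum_int.
by rewrite cabsM ler_peMl ?cabs_ge0.
Qed.

(** The preimage of [be] is chosen close to [- th j]; the division by [q] contracts the angle
    inherited from the higher digits. *)
Lemma block_sum_step_good kap r j n be : near_linear kap j ->
  `|be + th j.+1| <= r -> exists al, `|al + th j| <= (r + kap) / q%:R /\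
  cabs (digit_sum q f j al) * cabs (block_sum q f j.+1 n be) <=
    cabs (block_sum q f j n.+1 al).
Proof.
move=> [[k hk] _] hr.
have q0 : 0 < q%:R :> R by rewrite ltr0n ltnW.
exists ((be + k%:~R) / q%:R); split.
  have -> : (be + k%:~R) / q%:R + th j =
     ((be + th j.+1) - (th j.+1 - q%:R * th j - k%:~R)) / q%:R.
    by field; rewrite gt_eqF.
  rewrite normrM normfV (gtr0_norm q0) ler_pM2r ?invr_gt0//.
  exact: le_trans (ler_normB _ _) (lerD hr hk).
by rewrite block_sumS// [q%:R * _]mulrC divfK ?gt_eqF// block_sum_int cabsM.
Qed.

(* [m] counts the good digits since the last bad one.  A bad digit leaves an error
   of at most 1/2 on the angle, which the next [K] good digits contract below
   [2 kap]; each of these [K + 1] digits costs a factor [rho], the others only [e]. *)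
Lemma block_sum_lower (kap e rho r0 : R) (K : nat) (bad : nat -> bool) :
  0 < rho -> rho * q%:R <= 1 -> 0 <= e <= 1 -> 0 < kap ->
  kap <= (1 - e) / 2 -> kap <= 1 / (8 * q%:R) -> kap <= r0 / 2 -> rho <= r0 / 2 ->
  2^-1 ^+ K.+1 <= kap ->
  (forall t, `|t| <= 2 * q%:R * kap -> cabs (ee t - 1) <= (1 - e) / 2) ->
  (forall x, `|x| <= (1 / 2 + 1 / (4 * q%:R)) / q%:R ->
    q%:R * r0 <= cabs (\sum_(i < q) ee (i%:R * x))) ->
  (forall j, ~~ bad j -> near_linear kap j) ->
  forall n j, exists al m, `|al + th j| <= kap + 2^-1 ^+ m.+1 /\
    q%:R ^+ n * (e ^+ n * rho ^+ (K.+1 * \sum_(i < n) bad (j + i) + minn m K)%N)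
      <= cabs (block_sum q f j n al).
Proof.
move=> rho0 rhoq /andP[e0 e1] kap0 ke kq kr rr Kk nee ndir hbad.
have q2 : 2 <= q%:R :> R by rewrite ler_nat.
have q0 : 0 < q%:R :> R by rewrite ltr0n ltnW.
have rho1 : rho <= 1 by nra.
elim=> [|n IH] j.
  exists (- th j), 0%N; rewrite addNr normr0; split.
    by rewrite addr_ge0 ?ltW// exprn_gt0.
  rewrite /block_sum expn0 big_ord1 mul0r ee0 mulr1 cabs_fshift// big_ord0 muln0 min0n.
  by rewrite !expr0 !mulr1.
have [be [m [hbe hlow]]] := IH j.+1.
have cntE : (\sum_(i < n.+1) bad (j + i) = bad j + \sum_(i < n) bad (j.+1 + i))%N.
  rewrite big_ord_recl addn0; congr (_ + _)%N; apply: eq_bigr => i _.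
  by rewrite /bump/= addnA addn1.
set B := (\sum_(i < n) bad (j.+1 + i))%N in hlow cntE.
rewrite cntE.
have pos k : 0 <= q%:R ^+ n * (e ^+ n * rho ^+ k).
  by rewrite !mulr_ge0 ?exprn_ge0// ltW.
have [bj|gj] := boolP (bad j).
- have [al [hal hb]] := block_sum_step_bad j n be.
  exists al, 0%N; split.
    by rewrite (le_trans hal)// expr1 mul1r lerDr ltW.
  apply: le_trans hb; apply: le_trans hlow.
  (* The counter falls back to 0. Of the [K + 1] new powers of [rho], one makes up for the missing
     factor [q], and [K] absorb the powers counted by [minn m K]. *)
  have -> : (K.+1 * (true + B) + minn 0 K = (K.+1 * B + K).+1)%N.
    by rewrite min0n addn0 add1n mulnS addSn (addnC K).
  rewrite [rho ^+ _.+1]exprS exprD.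
  have -> : q%:R ^+ n.+1 * (e ^+ n.+1 * (rho * (rho ^+ (K.+1 * B) * rho ^+ K))) =
     (rho * q%:R) * e * (q%:R ^+ n * (e ^+ n * (rho ^+ (K.+1 * B) * rho ^+ K))).
    by rewrite !exprS; ring.
  apply: le_trans (_ : q%:R ^+ n * (e ^+ n * (rho ^+ (K.+1 * B) * rho ^+ K)) <= _).
    rewrite ler_piMl//; first by rewrite -exprD.
    by rewrite mulr_ile1// mulr_ge0// ltW.
  rewrite ler_wpM2l ?exprn_ge0// ?ler_wpM2l ?exprn_ge0// ?(ltW q0)//.
  rewrite exprD ler_wpM2l ?exprn_ge0 ?(ltW rho0)//.
  by rewrite ler_wiXn2l ?geq_minr// ltW.
have gd := hbad _ gj.
have [al [hal hb]] := block_sum_step_good n gd hbe.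
have ds := digit_sum_near al gd.
set x := al + th j in hal ds.
have P0 : 0 < 2^-1 ^+ m.+1 :> R by rewrite exprn_gt0.
have P1 : 2^-1 ^+ m.+1 <= 1 / 2 :> R.
  by rewrite exprS div1r ler_piMr// exprn_ile1// invf_le1// ler1n.
exists al, m.+1; split.
  apply: (le_trans hal); rewrite ler_pdivrMr// [2^-1 ^+ m.+2]exprS.
  by move: P0 P1; set P := 2^-1 ^+ m.+1; nra.
apply: le_trans hb; rewrite add0n.
have hx1 : `|x| <= (1 / 2 + 1 / (4 * q%:R)) / q%:R.
  apply: (le_trans hal); rewrite ler_pM2r ?invr_gt0//.
  have : 1 / (4 * q%:R) = 2 * (1 / (8 * q%:R)) :> R by field; rewrite gt_eqF.
  lra.
have hd := ndir _ hx1.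
(* For [m < K] the kernel bound [q r0] minus the error [q kap] leaves at least [q rho]. From [K] on
   the angle is at most [2 kap], all [q] terms are within [(1 - e) / 2] of 1, and at least [q e] is
   left. *)
have [mK|Km] := ltnP m K.
- rewrite (minn_idPl mK).
  have hm : minn m K = m by rewrite (minn_idPl (ltnW mK)).
  rewrite hm in hlow.
  apply: le_trans (_ : q%:R * rho * (q%:R ^+ n * (e ^+ n * rho ^+ (K.+1 * B + m)%N)) <= _).
    rewrite addnS.
    have -> : q%:R ^+ n.+1 * (e ^+ n.+1 * rho ^+ (K.+1 * B + m).+1) =
      e * (q%:R * rho * (q%:R ^+ n * (e ^+ n * rho ^+ (K.+1 * B + m)))).
      by rewrite !exprS; ring.
    by rewrite ler_piMl// mulr_ge0// mulr_ge0// ltW.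
  rewrite ler_pM// ?mulr_ge0 ?(ltW q0) ?(ltW rho0)//.
  by rewrite (le_trans _ ds)//; nra.
- rewrite (minn_idPr (leqW Km)).
  rewrite (minn_idPr Km) in hlow.
  have -> : q%:R ^+ n.+1 * (e ^+ n.+1 * rho ^+ (K.+1 * B + K)%N) =
    q%:R * e * (q%:R ^+ n * (e ^+ n * rho ^+ (K.+1 * B + K)%N)).
    by rewrite !exprS; ring.
  rewrite ler_pM// ?mulr_ge0 ?(ltW q0)//.
  apply: le_trans ds.
  have hx2 : `|x| <= 2 * kap.
    apply: (le_trans hal); rewrite ler_pdivrMr//.
    have : 2^-1 ^+ m.+1 <= kap.
      by rewrite (le_trans _ Kk)// ler_wiXn2l// invf_le1// ler1n.
    nra.
  have : q%:R - cabs (\sum_(i < q) ee (i%:R * x)) <= q%:R * ((1 - e) / 2).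
    have -> : q%:R = cabs (q%:R : R[i]) by rewrite cabs_nat.
    apply: (le_trans (cabs_sub _ _)); rewrite cabs_nat.
    rewrite (_ : q%:R = \sum_(i < q) (1 : R[i])); last by rewrite sumr_const card_ord.
    rewrite -sumrB; apply: (le_trans (cabs_sum _ _ _)).
    rewrite mulr_natl -[X in _ *+ X](card_ord q) -sumr_const; apply: ler_sum => i _.
    rewrite cabsB; apply: nee; rewrite normrM ger0_norm//.
    have iq : i%:R <= q%:R :> R by rewrite ler_nat ltnW.
    have i0 : 0 <= i%:R :> R by [].
    rewrite [2 * _]mulrC -mulrA; apply: ler_pM => //.
  nra.
Qed.

Lemma gelfond_near_linear : gelfond_type f ->
  exists2 kap, 0 < kap & forall bad : nat -> bool, (forall j, ~~ bad j -> near_linear kap j) ->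
    exists c C : R, 0 < c /\ forall L, c * L%:R - C <= (\sum_(i < L) bad i)%:R.
Proof.
move=> [c [c0 [C hC]]].
have q2 : 2 <= q%:R :> R by rewrite ler_nat.
have q0 : 0 < q%:R :> R by rewrite ltr0n ltnW.
have lq : 0 < ln (q%:R : R) by rewrite ln_gt0// (lt_le_trans _ q2)// ltr1n.
(* This is [q ^ (- c / 2)]: good digits account for half of the Gelfond exponent, and the bad ones
   must pay for the other half. *)
pose e : R := expR (- (c * ln q%:R / 2)).
have e0 : 0 < e by exact: expR_gt0.
have e1 : e < 1 by rewrite /e expR_lt1 oppr_lt0 divr_gt0// mulr_gt0.
have [r0 /andP[r00 r01] ndir] := dirichlet_large R q1.
have [d d0 hd] := @ee_near1 R ((1 - e) / 2) ltac:(by rewrite divr_gt0// subr_gt0).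
pose kap := Num.min (Num.min ((1 - e) / 2) (1 / (8 * q%:R))) (Num.min (r0 / 2) (d / (2 * q%:R))).
have kap0 : 0 < kap.
  rewrite !lt_min !divr_gt0 ?subr_gt0 ?mulr_gt0//.
have [k1 k2 k3 k4] : [/\ kap <= (1 - e) / 2, kap <= 1 / (8 * q%:R), kap <= r0 / 2 & kap <= d / (2 * q%:R)].
  by have := lexx kap; rewrite {2}/kap !le_min => /andP[/andP[-> ->] /andP[-> ->]].
pose rho := Num.min (r0 / 2) (q%:R^-1).
have rho0 : 0 < rho by rewrite lt_min divr_gt0 ?invr_gt0.
have [rr1 rr2] : rho <= r0 / 2 /\ rho * q%:R <= 1.
  have := lexx rho; rewrite {2}/rho le_min => /andP[-> h]; split => //.
  by rewrite -ler_pdivlMr// div1r.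
have [K hK] : exists K, 2^-1 ^+ K.+1 <= kap.
  have : (fun n : nat => 2^-1 ^+ n : R^o) @ \oo --> (0 : R).
    by apply: cvg_expr; rewrite gtr0_norm// invf_lt1// ltr1n.
  move=> /cvgrPdist_le/(_ _ kap0)[K _ hK]; exists K.
  by have := hK K.+1 (leqnSn K); rewrite /= sub0r normrN ger0_norm// exprn_ge0.
exists kap => // bad hbad.
have low := block_sum_lower rho0 rr2 _ kap0 k1 k2 k3 rr1 hK _ ndir hbad.
pose g := - ln rho.
have g0 : 0 < g.
  rewrite oppr_gt0 ln_lt0// rho0 (le_lt_trans rr1)//; lra.
(* Obtained by taking logarithms in [e ^ L * rho ^ ((K + 1) (B + 1)) <= C * q ^ (- c L)], with [B]
   the number of bad digits below [L]. *)
exists (c * ln q%:R / 2 / (K.+1%:R * g)), (ln C / (K.+1%:R * g) + 1); split.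
  by rewrite !divr_gt0 ?mulr_gt0.
move=> L.
have [||al [m [_ hal]]] := low _ _ L 0%N.
- by rewrite (ltW e0) (ltW e1).
- move=> t ht; apply: hd; apply: (le_trans ht).
  by move: k4; rewrite ler_pdivlMr ?mulr_gt0//; lra.
have := hC (q ^ L)%N al; rewrite expn_gt0 (ltnW q1) => /(_ isT).
rewrite cabsM cabsV cabs_nat.
have -> : \sum_(n < q ^ L) f n * ee (n%:R * al) = block_sum q f 0 L al.
  by apply: eq_bigr => x _; rewrite /fshift expn0 mul1n.
have qL0 : 0 < (q ^ L)%:R :> R by rewrite ltr0n expn_gt0 (ltnW q1).
rewrite mulrC ler_pdivrMr// => up.
set B := (\sum_(i < L) bad i)%N.
have : e ^+ L * rho ^+ (K.+1 * B.+1) <= C * (q ^ L)%:R `^ (- c).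
  rewrite -(ler_pM2l qL0) [leRHS]mulrC; apply: le_trans up; apply: le_trans hal.
  rewrite natrX ler_pM2l ?exprn_gt0// ler_pM2l ?exprn_gt0//.
  rewrite ler_wiXn2l ?(ltW rho0)//; first by nra.
  rewrite -[(\sum_(i < L) bad (0 + i))%N]/B mulnS addnC leq_add2r.
  exact: leq_trans (geq_minr _ _) (leqnSn _).
have rhoE : rho = expR (- g) by rewrite /g opprK lnK.
have -> : (q ^ L)%:R `^ (- c) = expR (- c * (L%:R * ln q%:R)).
  rewrite natrX /powR gt_eqF ?exprn_gt0// lnXn//.
  by rewrite mulr_natl.
have LHS0 : 0 < e ^+ L * rho ^+ (K.+1 * B.+1) by rewrite mulr_gt0 ?exprn_gt0.
(* The positive left-hand side forces [C > 0], which permits the logarithm. *)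
move=> h; have C0 : 0 < C.
  by have := lt_le_trans LHS0 h; rewrite pmulr_lgt0// expR_gt0.
have CE : C = expR (ln C) by rewrite lnK.
rewrite CE in h; move: h; rewrite rhoE /e -!expRM_natl -!expRD ler_expR.
rewrite natrM -[B.+1%:R]natr1 => h.
rewrite lerBlDr -(@ler_pM2r _ (K.+1%:R * g)) ?mulr_gt0//.
rewrite mulrAC divfK ?mulf_neq0 ?gt_eqF// addrA.
rewrite !mulrDl [ln C / _ * _]divfK ?mulf_neq0 ?gt_eqF//.
move: h; set KK := K.+1%:R; set b := B%:R; nra.
Qed.

End Counting.

(** * The power saving *)

Section PowerSaving.
Variables (R : realType) (q : nat) (f : nat -> R[i]).
Hypotheses (q1 : (1 < q)%N) (f1 : unimodular f) (fM : q_multiplicative q f).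
Hypothesis fG : gelfond_type f.

Lemma gelfond_hits D : exists (t : nat) (del c C : R),
  [/\ 0 < del <= 1, 0 < c &
   forall L, c * L%:R - C <= (\sum_(i < L) hit q f D t.+2 del i)%:R].
Proof.
have q0 : 0 < q%:R :> R by rewrite ltr0n ltnW.
have [th thE] := choice (fun j => ee_surj (f1 (q ^ j)%N)).
have [kap kap0 hkap] := gelfond_near_linear q1 f1 fM th fG.
(* Turns closeness of values of [ee] back into closeness of angles modulo 1. *)
have [kap2 kap20 hk2] := ee_far1 kap0.
pose del : R := Num.min 1 (Num.min kap (kap2 / 2) / (2 * q%:R)).
have del0 : 0 < del.
  by rewrite lt_min ltr01 divr_gt0 ?mulr_gt0// lt_min kap0 divr_gt0.
have del1 : del <= 1 by rewrite ge_min lexx.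
have [dk dk2] : 2 * del * q%:R <= kap /\ 2 * del * q%:R <= kap2 / 2.
  have : del <= Num.min kap (kap2 / 2) / (2 * q%:R) by rewrite ge_min lexx orbT.
  rewrite ler_pdivlMr ?mulr_gt0// (_ : del * _ = 2 * del * q%:R); last by ring.
  by rewrite le_min => /andP[].
clearbody del.
have Dq : (D < q ^ D)%N by exact: ltn_expl.
(* A missing hit at [j - D] makes [f] nearly linear at digit [j]. The first [D] digits have no such
   predecessor; calling them bad costs [D] in the constant. *)
pose bad j := (j < D)%N || hit q f D D.+2 del (j - D).
have hbad j : ~~ bad j -> near_linear q f th kap j.
  rewrite negb_or -leqNgt => /andP[Dj nh].
  have lin m : (m <= q)%N -> cabs (f (q ^ j * m)%N - ee (m%:R * th j)) <= 2 * del * q%:R.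
    move=> mq; have := fshift_pow q1 f1 fM Dq mq (ltW del0) nh.
    by rewrite subnK// thE eeX.
  split; last by move=> x xq; rewrite (le_trans (lin _ (ltnW xq))).
  apply: contrapT => /forallNP hk.
  have : kap2 <= cabs (ee (th j.+1 - q%:R * th j) - 1).
    by apply: hk2 => k; rewrite ltNge; apply/negP; exact: hk.
  rewrite eeB cabs_conj_sub1 ?cabs_ee//.
  have := lin q (leqnn _); rewrite -expnSr thE; lra.
have [c [C [c0 hc]]] := hkap bad hbad.
exists D, del, c, (C + D%:R); split; rewrite ?del0// => L.
have := hc (D + L)%N; rewrite big_split_ord/= natrD mulrDr => h.
have h1 : (\sum_(i < D) bad i)%:R <= D%:R :> R.
  rewrite ler_nat -[leqRHS]muln1 -[X in (X * 1)%N]card_ord -sum_nat_const.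
  by apply: leq_sum => i _; case: (bad i).
have h2 : (\sum_(i < L) bad (D + i)%N)%:R = (\sum_(i < L) hit q f D D.+2 del i)%:R :> R.
  congr (_%:R); apply: eq_bigr => i _.
  by rewrite /bad addKn ltnNge leq_addr.
have h3 : 0 <= c * D%:R by rewrite mulr_ge0// ltW.
move: h; rewrite natrD h2; lra.
Qed.

Lemma phase_bound_pow D : exists a C : R, [/\ 0 < a, 0 < C &
  forall (L : nat) (P : {poly R}), (size P <= D.+1)%N ->
  cabs (\sum_(n < q ^ L) f n * ee P.[n%:R]) <= (q ^ L)%:R * (C * expR (- a * L%:R))].
Proof.
have [t [del [c [C [/andP[del0 del1] c0 hh]]]]] := gelfond_hits D.
set s := t.+2 in hh.
pose ga := gain q D s del.
have Q0 : 0 < (q ^ s)%:R^-1 :> R by rewrite invr_gt0 ltr0n expn_gt0 ltnW.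
have Q1 : (q ^ s)%:R^-1 <= 1 :> R.
  by rewrite invf_le1 ?ltr0n ?expn_gt0 ?(ltnW q1)// ler1n expn_gt0 (ltnW q1).
have B0 : 0 < 2^-1 ^+ D.+1 :> R by rewrite exprn_gt0.
have B1 : 2^-1 ^+ D.+1 <= 1 :> R by rewrite exprn_ile1// invf_le1// ler1n.
have d20 : 0 < del ^+ 2 / 2 by rewrite divr_gt0// exprn_gt0.
have d21 : del ^+ 2 / 2 <= 1 / 2 by rewrite ler_pM2r// exprn_ile1// ltW.
have ga1 : ga < 1 by rewrite /ga /gain gtrBl mulr_gt0// mulr_gt0.
have ga0 : 0 < ga.
  rewrite /ga /gain subr_gt0; apply: (@le_lt_trans _ _ (1 * (1 * (1 / 2)))); last by lra.
  have BD : 0 < 2^-1 ^+ D.+1 * (del ^+ 2 / 2) by rewrite mulr_gt0.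
  apply: ler_pM; [exact: ltW|exact: ltW|exact: Q1|].
  by apply: ler_pM; [exact: ltW|exact: ltW|exact: B1|].
pose g := - ln ga.
have g0 : 0 < g by rewrite oppr_gt0 ln_lt0// ga0.
have gaE : ga = expR (- g) by rewrite /g opprK lnK.
clearbody g.
pose M : R := (2 ^ D.+1)%:R.
have M0 : 0 < M by rewrite ltr0n expn_gt0.
have s0 : 0 < s%:R :> R by rewrite ltr0n.
(* From [ga ^ k] with [k >= (c L - C) / s - 1], after a root of order [M = 2 ^ (D + 1)]. *)
exists (g * c / (s%:R * M)), (expR (g * (C / s%:R + 1) / M)); split.
- by rewrite divr_gt0 ?mulr_gt0.
- exact: expR_gt0.
move=> L P sP.
have [G [k [dG /andP[G0 Gk] hk]]] :=
  decomp_hits q1 f1 fM D L 0%N (isT : 0 < s)%N (ltW del0).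
have bd := decomp_phase dG sP.
have fE : \sum_(x < q ^ L) fshift q f 0 x * ee P.[x%:R] = \sum_(n < q ^ L) f n * ee P.[n%:R].
  by apply: eq_bigr => x _; rewrite /fshift expn0 mul1n.
rewrite fE in bd.
have kL : c * L%:R - C <= s%:R * (k%:R + 1).
  by apply: (le_trans (hh L)); rewrite natr1 -natrM ler_nat.
have step : cabs (\sum_(n < q ^ L) f n * ee P.[n%:R]) <= (q ^ L)%:R * expR (- g * k%:R / M).
  rewrite -(@ler_pXn2r _ (2 ^ D.+1)) ?expn_gt0 ?nnegrE ?cabs_ge0 ?mulr_ge0 ?expR_ge0//.
  apply: (le_trans bd); rewrite exprMn ler_wpM2l ?exprn_ge0//.
  apply: (le_trans Gk); rewrite -/ga gaE -!expRM_natl -/M.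
  by rewrite [M * _]mulrC divfK ?gt_eqF// mulrC.
apply: (le_trans step); rewrite ler_wpM2l// -expRD ler_expR.
have -> : g * (C / s%:R + 1) / M + - (g * c / (s%:R * M)) * L%:R =
   - (g / M) * ((c * L%:R - C) / s%:R - 1) by field; rewrite !gt_eqF.
have -> : - g * k%:R / M = - (g / M) * k%:R by ring.
rewrite !mulNr lerN2 ler_pM2l ?divr_gt0// lerBlDr ler_pdivrMr//.
by rewrite [_ * s%:R]mulrC.
Qed.

Lemma phase_bound D : exists c C : R, [/\ 0 < c, 0 < C &
  forall (N : nat) (P : {poly R}), (0 < N)%N -> (size P <= D.+1)%N ->
  cabs (\sum_(n < N) f n * ee P.[n%:R]) <= N%:R * (C * N%:R `^ (- c))].
Proof.
have [a [C [a0 C0 hL]]] := phase_bound_pow D.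
have q2 : 2 <= q%:R :> R by rewrite ler_nat.
have q0 : 0 < q%:R :> R by rewrite ltr0n ltnW.
have lq : 0 < ln (q%:R : R) by rewrite ln_gt0// (lt_le_trans _ q2)// ltr1n.
(* A block of length [q ^ i] saves [exp (- a i)], the incomplete last block [q ^ (- i)]; [b] is the
   smaller rate. *)
have [b [b0 ba bq]] : exists b, [/\ 0 < b, b <= a & b <= ln (q%:R : R)].
  by exists (Num.min a (ln q%:R)); rewrite lt_min a0 !ge_min !lexx orbT.
exists (b / (2 * ln q%:R)), ((C + 1) * expR b); split.
- by rewrite divr_gt0 ?mulr_gt0.
- by rewrite mulr_gt0 ?expR_gt0 ?addr_gt0.
move=> N P N0 sP.
have NR : 0 < N%:R :> R by rewrite ltr0n.
(* Blocks of length about the square root of [N] leave a remainder of relative size at most [1 / Q].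
   The [2] in the upper exponent costs the factor [expR b]. *)
have [i [QN NQ]] : exists i, (q ^ i * q ^ i <= N < q ^ (i + i + 2))%N /\ True.
  exists (trunc_log q N)./2; split => //; apply/andP; split.
    rewrite -expnD addnn; apply: (@leq_trans (q ^ trunc_log q N)); last exact: trunc_logP.
    by rewrite leq_exp2l// -[leqRHS]odd_double_half leq_addl.
  apply: leq_trans (trunc_log_ltn N q1) _; rewrite leq_exp2l//.
  have := odd_double_half (trunc_log q N); rewrite -addnn.
  by move: (_./2) => y <-; case: (odd _); lia.
move/andP: QN NQ => [QN NQ] _.
set Q := (q ^ i)%N in QN.
have Q0 : (0 < Q)%N by rewrite expn_gt0 ltnW.
set M := (N %/ Q)%N; set r := (N %% Q)%N.
have NE : N = (Q * M + r)%N by rewrite mulnC -divn_eq.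
have main : cabs (\sum_(n < Q * M) f n * ee P.[n%:R]) <= M%:R * (Q%:R * (C * expR (- a * i%:R))).
  rewrite (sum_ord_mul Q M (fun n => f n * ee P.[n%:R])).
  apply: (le_trans (cabs_sum _ _ _)).
  rewrite [leRHS]mulr_natl -[X in _ *+ X](card_ord M) -sumr_const; apply: ler_sum => y _.
  have -> : \sum_(m < Q) f (m + Q * y)%N * ee P.[(m + Q * y)%:R] =
     f (Q * y)%N * \sum_(m < Q) f m * ee (P \Po ('X + ((Q * y)%:R)%:P)).[m%:R].
    rewrite mulr_sumr; apply: eq_bigr => m _; rewrite mulrA [f _ * f m]mulrC.
    by rewrite (fM (t := i)) ?dvdn_mulr// horner_comp !hornerE natrD.
  rewrite cabsM f1 mul1r; apply: hL.
  rewrite (leq_trans (size_comp_poly_leq _ _))// size_XaddC/= muln1.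
  by move: sP; case: (size P).
have rest : cabs (\sum_(n < N) f n * ee P.[n%:R]) <=
    M%:R * (Q%:R * (C * expR (- a * i%:R))) + Q%:R.
  have split x y (F : nat -> R[i]) z : z = (x + y)%N ->
      \sum_(n < z) F n = \sum_(n < x) F n + \sum_(n < y) F (x + n)%N.
    by move=> ->; rewrite big_split_ord.
  rewrite (split _ _ (fun n => f n * ee P.[n%:R]) _ NE); apply: le_trans (cabsD _ _) (lerD main _).
  apply: le_trans (cabs_sum _ _ _) _; under eq_bigr do rewrite cabsM f1 cabs_ee mul1r.
  by rewrite sumr_const card_ord ler_nat ltnW// ltn_mod.
apply: (le_trans rest).
have h1 : M%:R * (Q%:R * (C * expR (- a * i%:R))) <= N%:R * (C * expR (- b * i%:R)).
  rewrite mulrA -natrM; apply: ler_pM; rewrite ?mulr_ge0 ?expR_ge0 ?(ltW C0)//.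
    by rewrite ler_nat leq_trunc_div.
  by rewrite ler_pM2l// ler_expR !mulNr lerN2 ler_wpM2r.
have h2 : Q%:R <= N%:R * expR (- b * i%:R).
  have QE : Q%:R = expR (i%:R * ln q%:R) :> R by rewrite expRM_natl lnK// natrX.
  apply: le_trans (_ : N%:R * expR (- (i%:R * ln q%:R)) <= _).
    by rewrite expRN -QE ler_pdivlMr ?ltr0n// -natrM ler_nat.
  by rewrite ler_pM2l// ler_expR mulNr lerN2 mulrC ler_wpM2l.
apply: le_trans (lerD h1 h2) _; rewrite -mulrDr ler_pM2l//.
rewrite -[X in _ + X]mul1r -mulrDl -mulrA ler_pM2l ?addr_gt0//.
rewrite /powR gt_eqF// -expRD ler_expR.
have : ln N%:R <= (i%:R + i%:R + 2) * ln q%:R :> R.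
  rewrite (_ : i%:R + i%:R + 2 = (i + i + 2)%:R); last by rewrite !natrD.
  by rewrite mulr_natl -lnXn// ler_ln ?posrE ?exprn_gt0// -natrX ler_nat ltnW.
move=> h.
have -> : - (b / (2 * ln q%:R)) * ln N%:R = - (b / 2) * (ln N%:R / ln q%:R).
  by field; rewrite gt_eqF.
by move: h; rewrite -ler_pdivrMr//; move: (ln N%:R / ln q%:R) => z h; nra.
Qed.

End PowerSaving.

(** * Transference to measure-preserving systems *)

Section Parseval.
Variable R : realType.

Lemma parseval (M : nat) (g : nat -> R[i]) : (0 < M)%N ->
  \sum_(k < M) cabs (\sum_(l < M) g l * ee (k%:R * (l%:R / M%:R))) ^+ 2 =
  M%:R * \sum_(l < M) cabs (g l) ^+ 2.
Proof.
move=> M0; apply: (@complexI R).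
rewrite rmorphM rmorph_nat !rmorph_sum/= mulr_sumr.
transitivity (\sum_(k < M) \sum_(l < M) \sum_(m < M)
    (g l * (g m)^*%C) * ee (k%:R * (((l : nat)%:Z - (m : nat)%:Z)%:~R / M%:R))).
  apply: eq_bigr => k _; rewrite -mulc_conj rmorph_sum/= mulr_suml.
  apply: eq_bigr => l _; rewrite mulr_sumr; apply: eq_bigr => m _.
  rewrite rmorphM/= mulrACA; congr (_ * _); rewrite -eeB; congr ee.
  by rewrite intrB -!pmulrn; ring.
rewrite exchange_big/=; apply: eq_bigr => l _; rewrite exchange_big/=.
rewrite (bigD1 l)//= [X in _ + X]big1 ?addr0 => [|m ml].
  under eq_bigr do rewrite subrr mul0r mulr0 ee0 mulr1.
  by rewrite sumr_const card_ord -mulc_conj mulr_natl.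
rewrite -mulr_sumr sum_ee_geom ?mulr0//.
  by rewrite normr_gt0; move: ml; rewrite -val_eqE/=; lia.
by have := ltn_ord l; have := ltn_ord m; lia.
Qed.

Lemma sum_periodic_shift (V : zmodType) (M : nat) (F : nat -> V) a :
  (forall l, F (l + M)%N = F l) -> \sum_(l < M) F (l + a)%N = \sum_(l < M) F l.
Proof.
move=> per; elim: a => [|a IH]; first by apply: eq_bigr => l _; rewrite addn0.
rewrite -{}IH -!(big_mkord xpredT (fun l => F (l + _)%N)).
case: M per => [|M] per; first by rewrite !big_geq.
rewrite big_nat_recr//= [RHS]big_nat_recl//= add0n addrC; congr (_ + _).
  by rewrite addnS -addSn addnC per.
by apply: eq_bigr => l _; rewrite addnS.
Qed.

(** The operator commutes with translations of [Z/MZ], so the Fourier transform turns it into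
    multiplication by [sum f n * ee (- k * pn n / M)], of modulus at most [W]; [parseval]
    concludes. *)
Lemma dft_bound (M N : nat) (g : nat -> R) (f : nat -> R[i]) (pn : nat -> nat) (W : R) :
  (0 < M)%N ->
  (forall al, cabs (\sum_(n < N) f n * ee (al * (pn n)%:R)) <= W) ->
  \sum_(l < M) cabs (\sum_(n < N) f n * (g ((l + pn n) %% M)%N)%:C%C) ^+ 2 <=
  W ^+ 2 * \sum_(l < M) g l ^+ 2.
Proof.
move=> M0 hW; have MR : 0 < M%:R :> R by rewrite ltr0n.
have W0 : 0 <= W := le_trans (cabs_ge0 _) (hW 0).
rewrite -(ler_pM2l MR) -(parseval
  (fun l => \sum_(n < N) f n * (g ((l + pn n) %% M)%N)%:C%C) M0) mulrCA.
have -> : \sum_(l < M) g l ^+ 2 = \sum_(l < M) cabs (g l)%:C%C ^+ 2.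
  by apply: eq_bigr => l _; rewrite cabsR real_normK ?num_real.
rewrite -(parseval (fun l => (g l)%:C%C) M0) mulr_sumr; apply: ler_sum => k _.
rewrite -exprMn ler_pXn2r ?nnegrE ?mulr_ge0 ?cabs_ge0//.
pose t : R := k%:R / M%:R.
have perE l x : ee (k%:R * ((l + x * M)%:R / M%:R)) = ee (k%:R * (l%:R / M%:R)) :> R[i].
  rewrite natrD natrM mulrDl mulfK ?gt_eqF// mulrDr eeD -natrM.
  by rewrite ee_nat mulr1.
have -> : \sum_(l < M) (\sum_(n < N) f n * (g ((l + pn n) %% M)%N)%:C%C) *
    ee (k%:R * (l%:R / M%:R)) =
  (\sum_(n < N) f n * ee (- t * (pn n)%:R)) *
    \sum_(l < M) (g l)%:C%C * ee (k%:R * (l%:R / M%:R)).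
  under eq_bigr do rewrite mulr_suml.
  rewrite exchange_big/= mulr_suml; apply: eq_bigr => n _.
  rewrite -mulrA mulr_sumr.
  pose F l := (g (l %% M)%N)%:C%C * ee (k%:R * (l%:R / M%:R)).
  transitivity (f n * ee (- t * (pn n)%:R) * \sum_(l < M) F (l + pn n)%N).
    rewrite mulr_sumr; apply: eq_bigr => l _; rewrite /F -!mulrA; congr (_ * _).
    rewrite [RHS]mulrCA; congr (_ * _); rewrite -eeD; congr ee.
    by rewrite /t natrD; ring.
  rewrite sum_periodic_shift.
    rewrite -mulrA; congr (_ * _); rewrite mulr_sumr.
    by apply: eq_bigr => l _; rewrite /F modn_small.
  by move=> l; rewrite /F modnDr; have := perE l 1%N; rewrite mul1n => ->.
by rewrite cabsM ler_wpM2r ?cabs_ge0.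
Qed.

End Parseval.

(** * From orbits to integrals *)

Section Averages.
Context d (X : measurableType d) (R : realType) (mu : probability X R) (T : X -> X).
Hypothesis mpT : measure_preserving mu T.

Lemma measurable_iter n : measurable_fun setT (iter n T).
Proof.
elim: n => [|n IH]; first exact: measurable_id.
exact: (measurableT_comp mpT.1 IH).
Qed.

Lemma integral_iter (h : X -> \bar R) n : measurable_fun setT h ->
  (forall x, (0 <= h x)%E) -> (\int[mu]_x h (iter n T x) = \int[mu]_x h x)%E.
Proof.
move=> mh h0; elim: n => [//|n IH]; rewrite -[RHS]IH.
have mhn : measurable_fun setT (fun x => h (iter n T x)).
  exact: (measurableT_comp mh (measurable_iter n)).
under eq_integral do rewrite iterSr.
transitivity (\int[pushforward mu T]_x h (iter n T x))%E.
  by rewrite (ge0_integral_pushforward mpT.1).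
apply: eq_measure_integral => [|mp A mA _]; first exact: mpT.1.
exact: mpT.2.
Qed.

Lemma measurable_wsum (F : X -> R) (c : nat -> R) (pn : nat -> nat) N :
  measurable_fun setT F ->
  measurable_fun setT (fun x => \sum_(n < N) c n * F (iter (pn n) T x)).
Proof.
move=> mF; apply: measurable_sum => n.
apply: measurable_funM; first exact: measurable_cst.
exact: (measurableT_comp mF (measurable_iter _)).
Qed.

Definition wsum (f : nat -> R[i]) (pn : nat -> nat) (N : nat) (F : X -> R) (x : X) : R :=
  cabs (\sum_(n < N) f n * (F (iter (pn n) T x))%:C%C).

Lemma measurable_wsum_cabs2 f pn N F : measurable_fun setT F ->
  measurable_fun setT (fun x => wsum f pn N F x ^+ 2).
Proof.
move=> mF; rewrite (_ : (fun x => _) = (fun x =>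
    (\sum_(n < N) Re (f n) * F (iter (pn n) T x)) ^+ 2 +
    (\sum_(n < N) Im (f n) * F (iter (pn n) T x)) ^+ 2)); last first.
  apply/funext => x; rewrite /wsum cabs2E Re_sum Im_sum.
  by congr (_ ^+ 2 + _ ^+ 2); apply: eq_bigr => n _; rewrite ?Re_mulR ?Im_mulR.
apply: measurable_funD; apply: measurable_funX.
- exact: (measurable_wsum (fun n => Re (f n)) pn N mF).
- exact: (measurable_wsum (fun n => Im (f n)) pn N mF).
Qed.

Lemma wsum_ge0 f pn N F x : 0 <= wsum f pn N F x.
Proof. exact: cabs_ge0. Qed.

Lemma measurable_wsum_cabs f pn N F : measurable_fun setT F ->
  measurable_fun setT (wsum f pn N F).
Proof.
move=> mF; have h := measurable_wsum_cabs2 f pn N mF.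
have -> : wsum f pn N F = (fun y => y `^ 2^-1) \o (fun x => wsum f pn N F x ^+ 2).
  apply/funext => x /=; rewrite powR12_sqrt ?sqr_ge0//.
  by rewrite sqrtr_sqr ger0_norm// wsum_ge0.
exact: (measurableT_comp (@measurable_powR R 2^-1) h).
Qed.

(** Calderon's transference: [dft_bound] is applied on [Z/2KZ] to the values of [F] along an orbit,
    where [K] exceeds every [pn n]. For [l < K] no index wraps around, so the sums at [T^l x]
    appear; invariance of the measure leaves the ratio [2K / K = 2]. *)
Lemma integral_wsum2 (f : nat -> R[i]) (pn : nat -> nat) N (F : X -> R) (W : R) : measurable_fun setT F ->
  (forall al, cabs (\sum_(n < N) f n * ee (al * (pn n)%:R)) <= W) ->
  (\int[mu]_x (wsum f pn N F x ^+ 2)%:E <= (2 * W ^+ 2)%:E * \int[mu]_x (F x ^+ 2)%:E)%E.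
Proof.
move=> mF hW.
pose K := (\sum_(n < N) pn n).+1.
have pK (n : 'I_N) : (pn n < K)%N by rewrite ltnS (bigD1 n)//= leq_addr.
have K0 : 0 < K%:R :> R by rewrite ltr0n.
pose h x := (wsum f pn N F x ^+ 2)%:E.
have mh : measurable_fun setT h by apply/measurable_EFinP; exact: measurable_wsum_cabs2.
have mF2 : measurable_fun setT (fun x => (F x ^+ 2)%:E).
  by apply/measurable_EFinP; exact: measurable_funX.
have mit (k : X -> \bar R) n : measurable_fun setT k ->
    measurable_fun setT (fun x => k (iter n T x)).
  by move=> mk; exact: (measurableT_comp mk (measurable_iter n)).
have pw x : (\sum_(l < K) h (iter l T x) <=
    (W ^+ 2)%:E * \sum_(l < K + K) (F (iter l T x) ^+ 2)%:E)%E.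
  rewrite !sumEFin -EFinM lee_fin.
  have := @dft_bound R (K + K)%N N (fun l => F (iter l T x)) f pn W isT hW.
  apply: le_trans; rewrite big_split_ord/= -[leLHS]addr0; apply: lerD; last first.
    by apply: sumr_ge0 => i _; rewrite sqr_ge0.
  apply: ler_sum => l _; rewrite le_eqVlt; apply/orP; left; apply/eqP.
  congr (cabs _ ^+ 2); apply: eq_bigr => n _.
  rewrite modn_small; first by rewrite addnC iterD.
  by rewrite -addSn leq_add// ltnW.
have : (\int[mu]_x (\sum_(l < K) h (iter l T x)) <=
   \int[mu]_x ((W ^+ 2)%:E * \sum_(l < K + K) (F (iter l T x) ^+ 2)%:E))%E.
  apply: ge0_le_integral => //.
  - by move=> x _; apply: sume_ge0 => l _; rewrite lee_fin sqr_ge0.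
  - by apply: emeasurable_sum => l; exact: mit.
  - apply: measurable_funeM; apply: emeasurable_sum => l.
    exact: (mit (fun x => (F x ^+ 2)%:E)).
rewrite ge0_integral_sum//; last 2 first.
- by move=> l; exact: mit.
- by move=> l x _; rewrite lee_fin sqr_ge0.
rewrite ge0_integralZl_EFin ?sqr_ge0//; last 2 first.
- by move=> x _; apply: sume_ge0 => l _; rewrite lee_fin sqr_ge0.
- by apply: emeasurable_sum => l; exact: (mit (fun x => (F x ^+ 2)%:E)).
rewrite ge0_integral_sum//; last 2 first.
- by move=> l; exact: (mit (fun x => (F x ^+ 2)%:E)).
- by move=> l x _; rewrite lee_fin sqr_ge0.
have sumc (k : X -> \bar R) n : measurable_fun setT k -> (forall x, (0 <= k x)%E) ->
    (\sum_(l < n) \int[mu]_x k (iter l T x) = n%:R%:E * \int[mu]_x k x)%E.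
  move=> mk k0; rewrite (eq_bigr (fun=> (\int[mu]_x k x)%E)); last first.
    by move=> l _; rewrite integral_iter.
  by rewrite sumr_const card_ord mule_natl.
rewrite sumc//; last by move=> x; rewrite lee_fin sqr_ge0.
rewrite (sumc (fun x => (F x ^+ 2)%:E))//; last by move=> x; rewrite lee_fin sqr_ge0.
have -> : ((W ^+ 2)%:E * ((K + K)%:R%:E * \int[mu]_x (F x ^+ 2)%:E) =
   K%:R%:E * ((2 * W ^+ 2)%:E * \int[mu]_x (F x ^+ 2)%:E))%E.
  by rewrite !muleA -!EFinM natrD; congr (_%:E * _)%E; ring.
by rewrite lee_pmul2l.
Qed.

Lemma integral_prob_cst (r : R) : (\int[mu]_x r%:E = r%:E)%E.
Proof.
rewrite integral_cst//; apply: etrans (mule1 _).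
exact: (congr1 (fun z => r%:E * z)%E (@probability_setT _ _ _ mu)).
Qed.

(** The inequality [a <= s + a^2 / s] with [s = W * lam] passes from the second moment to the first:
    [s + 2 s = 3 s]. *)
Lemma integral_wsum_bounded (f : nat -> R[i]) (pn : nat -> nat) N (F : X -> R) (W lam : R) :
  measurable_fun setT F -> (forall x, `|F x| <= lam) -> 0 < W -> 0 < lam ->
  (forall al, cabs (\sum_(n < N) f n * ee (al * (pn n)%:R)) <= W) ->
  (\int[mu]_x (wsum f pn N F x)%:E <= (3 * (W * lam))%:E)%E.
Proof.
move=> mF Fl W0 lam0 hW.
have s0 : 0 < W * lam by rewrite mulr_gt0.
have mA2 : measurable_fun setT (fun x => (wsum f pn N F x ^+ 2)%:E).
  by apply/measurable_EFinP; exact: measurable_wsum_cabs2.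
have F2 : (\int[mu]_x (F x ^+ 2)%:E <= (lam ^+ 2)%:E)%E.
  rewrite -[leRHS]integral_prob_cst.
  apply: ge0_le_integral => //.
  - by move=> x _; rewrite lee_fin sqr_ge0.
  - by apply/measurable_EFinP; exact: measurable_funX.
  - move=> x _; rewrite lee_fin -real_normK ?num_real// ler_pXn2r ?nnegrE//.
    exact: ltW.
have A2 := integral_wsum2 mF hW.
apply: (@le_trans _ _ (\int[mu]_x ((W * lam)%:E + (W * lam)^-1%:E * (wsum f pn N F x ^+ 2)%:E))%E).
  apply: ge0_le_integral => //.
  - by move=> x _; rewrite lee_fin wsum_ge0.
  - by apply/measurable_EFinP; exact: measurable_wsum_cabs.
  - by apply: emeasurable_funD => //; exact: measurable_funeM.
  - move=> x _; rewrite -EFinM -EFinD lee_fin.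
    have := wsum_ge0 f pn N F x; move: (wsum _ _ _ _ _) s0 => a; set s := W * lam => s0 a0.
    have := sqr_ge0 (a - s).
    rewrite -subr_ge0 => h; rewrite -(pmulr_rge0 _ s0).
    have -> : s * (s + s^-1 * a ^+ 2 - a) = s ^+ 2 + a ^+ 2 - s * a.
      by field; rewrite gt_eqF.
    nra.
rewrite ge0_integralD//; last 3 first.
- by move=> x _; rewrite lee_fin ltW.
- by move=> x _; rewrite -EFinM lee_fin mulr_ge0 ?sqr_ge0// invr_ge0 ltW.
- exact: measurable_funeM.
rewrite integral_prob_cst ge0_integralZl_EFin//; last 2 first.
- by move=> x _; rewrite lee_fin sqr_ge0.
- by rewrite invr_ge0 ltW.
apply: (@le_trans _ _ ((W * lam)%:E + (W * lam)^-1%:E * ((2 * W ^+ 2)%:E * (lam ^+ 2)%:E))%E).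
  rewrite leeD2l// lee_pmul2l// ?lte_fin ?invr_gt0//.
  apply: (le_trans A2); rewrite lee_pmul2l// lte_fin mulr_gt0// exprn_gt0//.
rewrite -!EFinM -EFinD lee_fin.
have -> : (W * lam)^-1 * (2 * W ^+ 2 * lam ^+ 2) = 2 * (W * lam).
  by field; rewrite !gt_eqF.
lra.
Qed.


End Averages.

(** * Almost everywhere convergence *)

Section PSeries.
Variable R : realType.

Lemma sum_powR_le (del : R) : 0 < del -> forall n : nat,
  \sum_(m < n) m.+1%:R `^ (- (1 + del)) <= 1 + del^-1.
Proof.
move=> del0 n.
(* The form that telescopes: each new term is at most [1 / del] times the decrease of [x ^ (- del)]
   over a unit step. *)
suff h : forall n, \sum_(m < n.+1) m.+1%:R `^ (- (1 + del)) <=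
    1 + del^-1 * (1 - n.+1%:R `^ (- del)).
  have dV : 0 < del^-1 by rewrite invr_gt0.
  case: n => [|n]; first by rewrite big_ord0 addr_ge0// ltW.
  apply: (le_trans (h n)); rewrite lerD2l; apply: ler_piMr; first exact: ltW.
  by have := powR_ge0 (n.+1%:R : R) (- del); lra.
elim=> [|k IH]; first by rewrite big_ord1 !powR1 subrr mulr0 addr0.
rewrite big_ord_recr/=; apply: le_trans (lerD IH (lexx _)) _.
suff : k.+2%:R `^ (- (1 + del)) <= del^-1 * (k.+1%:R `^ (- del) - k.+2%:R `^ (- del)).
  by rewrite !mulrBr; lra.
have k0 : 0 < k.+1%:R :> R by rewrite ltr0n.
have k1 : 0 < k.+2%:R :> R by rewrite ltr0n.
rewrite /powR !gt_eqF//; set a := ln k.+1%:R; set b := ln k.+2%:R.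
rewrite ler_pdivlMl//.
have ba : expR (- b) <= b - a.
  have := expR_ge1Dx (a - b).
  rewrite expRD expRN /a /b !lnK// -/a -/b => h.
  have : k.+1%:R / k.+2%:R = 1 - k.+2%:R^-1 :> R.
    have -> : k.+1%:R = k.+2%:R - 1 :> R by rewrite -[k.+2%:R]natr1 addrK.
    by rewrite mulrBl divff ?gt_eqF// mul1r.
  by move=> e; move: h; rewrite e; move: (k.+2%:R^-1) => v; lra.
have -> : - (1 + del) * b = - del * b - b by ring.
rewrite expRD.
have -> : - del * a = - del * b + del * (b - a) by ring.
rewrite [expR (_ + del * _)]expRD.
have h1 : 1 + del * (b - a) <= expR (del * (b - a)) := expR_ge1Dx _.
have h2 : del * expR (- b) <= expR (del * (b - a)) - 1.
  by rewrite lerBrDl (le_trans _ h1)// lerD2l ler_pM2l.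
have E0 : 0 < expR (- del * b) := expR_gt0 _.
rewrite mulrCA -[X in _ - X]mulr1 -mulrBr ler_pM2l//.
Qed.

(** A convex power lies below its chord on [[0, 1]]. *)
Lemma exprD1_gap (A : nat) (x : R) : 0 <= x <= 1 ->
  (1 + x) ^+ A - 1 <= 2 ^+ A * x.
Proof.
move=> /andP[x0 x1].
suff : (1 + x) ^+ A <= 1 + (2 ^+ A - 1) * x by have := mulr_ge0 x0 x0; nra.
elim: A => [|A IH]; first by rewrite !expr0 subrr mul0r addr0.
have P1 : 1 <= 2 ^+ A :> R by rewrite exprn_ege1// ler1n.
rewrite exprSr [2 ^+ A.+1]exprS.
apply: le_trans (_ : (1 + (2 ^+ A - 1) * x) * (1 + x) <= _).
  by rewrite ler_wpM2r// addr_ge0.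
move: P1; set P := 2 ^+ A => P1.
have : 0 <= (P - 1) * (x * (1 - x)) by rewrite !mulr_ge0// subr_ge0.
by lra.
Qed.

End PSeries.

Section AlmostEverywhere.
Context d (X : measurableType d) (R : realType) (mu : probability X R).

(** The integrals are summable, so the series has a finite integral and converges almost everywhere;
    its terms then tend to 0. *)
Lemma ae_cvg0 (h : nat -> X -> R) (K del : R) : 0 < del -> 0 <= K ->
  (forall m, measurable_fun setT (h m)) -> (forall m x, 0 <= h m x) ->
  (forall m, \int[mu]_x (h m x)%:E <= (K * m.+1%:R `^ (- (1 + del)))%:E)%E ->
  {ae mu, forall x, (fun m => h m x) @ \oo --> (0 : R)}.
Proof.
move=> del0 K0 mh h0 hK.
pose g x := (\sum_(0 <= m <oo) (h m x)%:E)%E.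
have mEh m : measurable_fun setT (fun x => (h m x)%:E) by apply/measurable_EFinP.
have h0E m x : setT x -> (0 <= (h m x)%:E)%E by rewrite lee_fin.
have mg : measurable_fun setT g.
  by apply: ge0_emeasurable_sum => // m x _ _; exact: h0E.
have g0 x : (0 <= g x)%E by apply: nneseries_ge0 => m _ _; exact: h0E.
have Ig : (\int[mu]_x g x <= (K * (1 + del^-1))%:E)%E.
  rewrite integral_nneseries//.
  apply: lime_le.
    by apply: is_cvg_nneseries => m _ _; apply: integral_ge0 => x; exact: h0E.
  near=> n.
  apply: le_trans (_ : (\sum_(0 <= m < n) (K * m.+1%:R `^ (- (1 + del)))%:E <= _)%E).
    by apply: lee_sum => m _; exact: hK.
  rewrite sumEFin lee_fin big_mkord -mulr_sumr ler_wpM2l//.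
  exact: sum_powR_le.
have ig : mu.-integrable setT g.
  apply/integrableP; split => //.
  under eq_integral do rewrite gee0_abs//.
  by apply: le_lt_trans Ig _; rewrite ltry.
have := integrable_ae measurableT ig.
apply: filterS => x /(_ I) gx.
apply: cvg_series_cvg_0.
apply: nondecreasing_is_cvgn.
  apply/nondecreasing_seqP => n; rewrite /series/= big_nat_recr//= lerDl.
  exact: h0.
exists (fine (g x)) => _ [n _ <-].
rewrite -lee_fin fineK// /series/= -sumEFin.
by apply: nneseries_lim_ge => m _ _; exact: h0E.
Unshelve. all: by end_near.
Qed.

End AlmostEverywhere.

(** * Truncation, and the averages along [N = k ^ A], for real-valued functions *)

Section RealPart.
Context d (X : measurableType d) (R : realType) (mu : probability X R) (T : X -> X).
Hypothesis mpT : measure_preserving mu T.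
Variables (f : nat -> R[i]) (pn : nat -> nat) (c C : R).
Hypotheses (f1 : unimodular f) (c0 : 0 < c) (C0 : 0 < C).
Hypothesis HW : forall (N : nat) al, (0 < N)%N ->
  cabs (\sum_(n < N) f n * ee (al * (pn n)%:R)) <= N%:R * (C * N%:R `^ (- c)).
Variables (r J : R) (F : X -> R).
Hypotheses (r1 : 1 < r) (J0 : 0 <= J) (mF : measurable_fun setT F).
Hypothesis FJ : (\int[mu]_x (`|F x| `^ r)%:E <= J%:E)%E.

Definition cut (lam : R) (x : X) : R := if lam < `|F x| then 0 else F x.
Definition tail (lam : R) (x : X) : R := if lam < `|F x| then `|F x| else 0.

Lemma measurable_gt lam : measurable_fun setT (fun x => lam < `|F x|).
Proof.
apply: measurable_fun_ltr; first exact: measurable_cst.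
exact: (measurableT_comp (@normr_measurable R setT) mF).
Qed.

Lemma measurable_cut lam : measurable_fun setT (cut lam).
Proof.
by apply: measurable_fun_ifT; [exact: measurable_gt|exact: measurable_cst|exact: mF].
Qed.

Lemma measurable_tail lam : measurable_fun setT (tail lam).
Proof.
apply: measurable_fun_ifT; [exact: measurable_gt| |exact: measurable_cst].
exact: (measurableT_comp (@normr_measurable R setT) mF).
Qed.

Lemma tail_ge0 lam x : 0 <= tail lam x.
Proof. by rewrite /tail; case: ifP. Qed.

Lemma cut_le lam x : 0 < lam -> `|cut lam x| <= lam.
Proof. by rewrite /cut => lam0; case: ltP => // _; rewrite normr0 ltW. Qed.

Lemma le_tail lam x : 0 < lam -> `|F x| <= lam + tail lam x.
Proof.
by rewrite /tail => lam0; case: ltP => h; rewrite ?addr0// lerDr ltW.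
Qed.

(** Where [|F| > lam], one has [|F| <= lam ^ (1 - r) * |F| ^ r]. *)
Lemma integral_tail lam : 0 < lam ->
  (\int[mu]_x (tail lam x)%:E <= (lam `^ (1 - r) * J)%:E)%E.
Proof.
move=> lam0.
have mP : measurable_fun setT (fun x => (`|F x| `^ r)%:E).
  apply/measurable_EFinP; apply: (measurableT_comp (@measurable_powR R r)).
  exact: (measurableT_comp (@normr_measurable R setT) mF).
apply: (@le_trans _ _ (\int[mu]_x ((lam `^ (1 - r))%:E * (`|F x| `^ r)%:E))%E).
  apply: ge0_le_integral => //.
  - by move=> x _; rewrite lee_fin tail_ge0.
  - by apply/measurable_EFinP; exact: measurable_tail.
  - exact: measurable_funeM.
  - move=> x _; rewrite -EFinM lee_fin /tail; case: ltP => h; last first.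
      by rewrite mulr_ge0 ?powR_ge0.
    have F0 : 0 < `|F x| := lt_trans lam0 h.
    rewrite -[X in X <= _]mul1r (_ : `|F x| `^ r = `|F x| `^ (r - 1) * `|F x|); last first.
      by rewrite -{3}[`|F x|]powRr1 ?ltW// -powRD ?subrK// (gt_eqF F0) implybT.
    rewrite mulrA ler_pM2r// -opprB powRN ler_pdivlMl ?powR_gt0// mulr1.
    by rewrite ge0_ler_powR ?nnegrE ?subr_ge0 ?ltW.
rewrite ge0_integralZl_EFin//; last first.
  by rewrite powR_ge0.
by rewrite EFinM lee_wpmul2l// lee_fin powR_ge0.
Qed.

Lemma integral_sum_tail lam (e : nat -> nat) M : 0 < lam ->
  (\int[mu]_x (\sum_(n < M) tail lam (iter (e n) T x))%:E <=
    (M%:R * (lam `^ (1 - r) * J))%:E)%E.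
Proof.
move=> lam0; have mt : measurable_fun setT (fun x => (tail lam x)%:E).
  by apply/measurable_EFinP; exact: measurable_tail.
under eq_integral do rewrite -sumEFin.
rewrite ge0_integral_sum//; last 2 first.
- by move=> n; exact: (measurableT_comp mt (measurable_iter mpT _)).
- by move=> n x _; rewrite lee_fin tail_ge0.
rewrite (eq_bigr (fun=> (\int[mu]_x (tail lam x)%:E)%E)); last first.
  by move=> n _; rewrite (integral_iter mpT (e n) mt)// => x; rewrite lee_fin tail_ge0.
rewrite (_ : (\sum_(n < M) _ = M%:R%:E * \int[mu]_x (tail lam x)%:E)%E); last first.
  by rewrite sumr_const card_ord mule_natl.
by rewrite EFinM lee_wpmul2l ?lee_fin// integral_tail.
Qed.

Lemma wsum_split lam N x :
  wsum T f pn N F x <= wsum T f pn N (cut lam) x + \sum_(n < N) tail lam (iter (pn n) T x).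
Proof.
rewrite /wsum.
have -> : \sum_(n < N) f n * (F (iter (pn n) T x))%:C%C =
    \sum_(n < N) f n * (cut lam (iter (pn n) T x))%:C%C +
    \sum_(n < N) f n * (F (iter (pn n) T x) - cut lam (iter (pn n) T x))%:C%C.
  rewrite -big_split/=; apply: eq_bigr => n _.
  by rewrite -mulrDr -rmorphD/= addrC subrK.
apply: le_trans (cabsD _ _) _; rewrite lerD2l.
apply: le_trans (cabs_sum _ _ _) _; apply: ler_sum => n _.
rewrite cabsM f1 mul1r cabsR /cut /tail; case: ifP => _; first by rewrite subr0.
by rewrite subrr normr0.
Qed.

Lemma integral_wsum_le N lam : (0 < N)%N -> 0 < lam ->
  (\int[mu]_x (wsum T f pn N F x)%:E <=
    (N%:R * (3 * C * N%:R `^ (- c) * lam + lam `^ (1 - r) * J))%:E)%E.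
Proof.
move=> N0 lam0.
have NR : 0 < N%:R :> R by rewrite ltr0n.
have mcut := measurable_cut lam.
have mt : measurable_fun setT (fun x => \sum_(n < N) tail lam (iter (pn n) T x)).
  apply: measurable_sum => n.
  exact: (measurableT_comp (measurable_tail lam) (measurable_iter mpT _)).
have t0 x : 0 <= \sum_(n < N) tail lam (iter (pn n) T x).
  by apply: sumr_ge0 => n _; exact: tail_ge0.
apply: (@le_trans _ _ (\int[mu]_x ((wsum T f pn N (cut lam) x)%:E +
    (\sum_(n < N) tail lam (iter (pn n) T x))%:E))%E).
  apply: ge0_le_integral => //.
  - by move=> x _; rewrite lee_fin wsum_ge0.
  - by apply/measurable_EFinP; exact: (measurable_wsum_cabs mpT).
  - apply: emeasurable_funD; apply/measurable_EFinP => //.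
    exact: (measurable_wsum_cabs mpT).
  - by move=> x _; rewrite -EFinD lee_fin wsum_split.
rewrite ge0_integralD//; last 4 first.
- by move=> x _; rewrite lee_fin wsum_ge0.
- by apply/measurable_EFinP; exact: (measurable_wsum_cabs mpT).
- by move=> x _; rewrite lee_fin.
- exact/measurable_EFinP.
have W0 : 0 < N%:R * (C * N%:R `^ (- c)) by rewrite !mulr_gt0// powR_gt0.
have h1 := integral_wsum_bounded mpT mcut (fun x => cut_le x lam0) W0 lam0
  (fun al => HW al N0).
have h2 := integral_sum_tail pn N lam0.
apply: (le_trans (leeD h1 h2)).
by rewrite -EFinD lee_fin le_eqVlt; apply/orP; left; apply/eqP; ring.
Qed.

Variables (A B : nat).
Hypotheses (hA : B%:R + 2 <= c * A%:R) (hB : 2 <= B%:R * (r - 1)).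

(** Up to a null sequence it dominates the averages for all [N] of the [k]-th block at once. At the
    level [sqrt k], the smaller values over a relative length [O(1/k)] add only [O(1 / sqrt k)],
    while the larger ones gain [k ^ ((1 - r) / 2)], which makes their share summable. *)
Definition gapfun (m : nat) (x : X) : R :=
  let k := m.+1 in
  (k ^ A)%:R^-1 * (wsum T f pn (k ^ A) F x +
    \sum_(n < k.+1 ^ A - k ^ A) tail (k%:R `^ 2^-1) (iter (pn (k ^ A + n)) T x)).

Lemma gap_le (k : nat) : (0 < k)%N ->
  (k ^ A)%:R^-1 * (k.+1 ^ A - k ^ A)%:R <= 2 ^+ A * k%:R^-1 :> R.
Proof.
move=> k0; have kR : 0 < k%:R :> R by rewrite ltr0n.
rewrite natrB ?leq_exp2r'//; last by case: A => // a; rewrite leq_exp2r.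
rewrite mulrBr mulVf ?pnatr_eq0 -?lt0n ?expn_gt0 ?k0// !natrX -exprVn -exprMn.
have -> : k%:R^-1 * k.+1%:R = 1 + k%:R^-1 :> R.
  by rewrite -natr1 mulrDr mulVf ?gt_eqF// mulr1.
apply: exprD1_gap; rewrite invr_ge0 ler0n/= invf_le1// ler1n//.
Qed.

(** With [N = k ^ A] and [lam = k ^ B], the hypotheses [hA] and [hB] bring both terms of
    [integral_wsum_le], divided by [N], down to [O(k ^ (- 2))]; the block term has exponent
    [- 1 - (r - 1) / 2]. Hence the two bounds on [del]. *)
Lemma integral_gapfun (del : R) m : 0 < del <= 1 -> del <= (r - 1) / 2 ->
  (\int[mu]_x (gapfun m x)%:E <=
    ((3 * C + J + 2 ^+ A * J) * m.+1%:R `^ (- (1 + del)))%:E)%E.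
Proof.
move=> /andP[del0 del1] delr.
set k := m.+1; have k0 : (0 < k)%N by [].
have kR : 0 < k%:R :> R by rewrite ltr0n.
have k1 : 1 <= k%:R :> R by rewrite ler1n.
have Nk0 : (0 < k ^ A)%N by rewrite expn_gt0.
have NkR : 0 < (k ^ A)%:R :> R by rewrite ltr0n.
have sq0 : 0 < k%:R `^ 2^-1 :> R by exact: powR_gt0.
have la0 : 0 < (k ^ B)%:R :> R by rewrite ltr0n expn_gt0.
pose S x := \sum_(n < k.+1 ^ A - k ^ A) tail (k%:R `^ 2^-1) (iter (pn (k ^ A + n)) T x).
have mS : measurable_fun setT S.
  apply: measurable_sum => n.
  exact: (measurableT_comp (measurable_tail _) (measurable_iter mpT _)).
have S0 x : 0 <= S x by apply: sumr_ge0 => n _; exact: tail_ge0.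
have mw : measurable_fun setT (wsum T f pn (k ^ A) F) by exact: (measurable_wsum_cabs mpT).
rewrite (_ : (fun x => (gapfun m x)%:E) = (fun x => ((k ^ A)%:R^-1)%:E *
   ((wsum T f pn (k ^ A) F x)%:E + (S x)%:E))%E); last by [].
rewrite ge0_integralZl_EFin ?invr_ge0 ?ler0n//; last 2 first.
- by move=> x _; rewrite -EFinD lee_fin addr_ge0 ?wsum_ge0.
- by apply: emeasurable_funD; apply/measurable_EFinP.
rewrite ge0_integralD//; last 4 first.
- by move=> x _; rewrite lee_fin wsum_ge0.
- exact/measurable_EFinP.
- by move=> x _; rewrite lee_fin.
- exact/measurable_EFinP.
have h1 := integral_wsum_le Nk0 la0.
have h2 := integral_sum_tail (fun n => pn (k ^ A + n)%N) (k.+1 ^ A - k ^ A) sq0.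
apply: (@le_trans _ _ (((k ^ A)%:R^-1)%:E * (_ + _))%E).
  by apply: lee_wpmul2l (leeD h1 h2); rewrite lee_fin invr_ge0 ltW.
rewrite -EFinD -EFinM lee_fin.
rewrite mulrDr [(k ^ A)%:R^-1 * (_ * _)]mulrA mulVf ?gt_eqF// mul1r.
rewrite [(k ^ A)%:R^-1 * (_ * _)]mulrA.
set z := k%:R `^ (- (1 + del)).
have e1 : (k ^ A)%:R `^ (- c) * (k ^ B)%:R <= z.
  rewrite !natrX -!powR_mulrn ?ler0n// -powRrM -powRD; last by rewrite (gt_eqF kR) implybT.
  rewrite ler_powR// mulrN [A%:R * c]mulrC.
  by move: hA; move: (c * A%:R) (B%:R : R) => u v; lra.
have e2 : (k ^ B)%:R `^ (1 - r) <= z.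
  by rewrite natrX -powR_mulrn ?ler0n// -powRrM ler_powR// -[1 - r]opprB mulrN;
    move: hB; move: (B%:R * (r - 1)) => u; lra.
have e3 : (k ^ A)%:R^-1 * (k.+1 ^ A - k ^ A)%:R * (k%:R `^ 2^-1) `^ (1 - r) <= 2 ^+ A * z.
  apply: le_trans (_ : 2 ^+ A * k%:R^-1 * (k%:R `^ 2^-1) `^ (1 - r) <= _).
    by rewrite ler_wpM2r ?powR_ge0// gap_le.
  rewrite -mulrA ler_wpM2l ?exprn_ge0// -powRrM -powR_inv1 ?ler0n//.
  rewrite -powRD; last by rewrite (gt_eqF kR) implybT.
  by rewrite ler_powR//; lra.
have f1' : 3 * C * (k ^ A)%:R `^ (- c) * (k ^ B)%:R <= 3 * C * z.
  by rewrite -mulrA ler_wpM2l// mulr_ge0// ltW.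
have f2 := ler_wpM2r J0 e2.
have f3 := ler_wpM2r J0 e3.
rewrite [_ * (_ * J)]mulrA; lra.
Qed.

Lemma wsum_gap m N x : (m.+1 ^ A <= N < m.+2 ^ A)%N ->
  N%:R^-1 * wsum T f pn N F x <= gapfun m x + 2 ^+ A * (m.+1%:R `^ 2^-1)^-1.
Proof.
move=> /andP[kN Nk]; set k := m.+1 in kN Nk *; have k0 : (0 < k)%N by [].
have kR : 0 < k%:R :> R by rewrite ltr0n.
have Nk0 : (0 < k ^ A)%N by rewrite expn_gt0.
have NkR : 0 < (k ^ A)%:R :> R by rewrite ltr0n.
set s := k%:R `^ 2^-1; have s0 : 0 < s by exact: powR_gt0.
have ss : s * s = k%:R.
  rewrite -powRD ?(gt_eqF kR) ?implybT//.
  by rewrite (_ : 2^-1 + 2^-1 = 1) ?powRr1 ?ltW//; lra.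
apply: le_trans (_ : (k ^ A)%:R^-1 * wsum T f pn N F x <= _).
  rewrite ler_wpM2r ?wsum_ge0// lef_pV2 ?posrE ?ler_nat//.
  by rewrite ltr0n (leq_trans Nk0).
rewrite /gapfun -/k -/s.
set S := \sum_(n < _) _.
(* Beyond [k ^ A] absolute values are taken and the sum is extended to the whole block, which frees
   the bound from [N]. *)
have main : wsum T f pn N F x <= wsum T f pn (k ^ A) F x + (S + (k.+1 ^ A - k ^ A)%:R * s).
  have split y z (G : nat -> R[i]) w : w = (y + z)%N ->
      \sum_(n < w) G n = \sum_(n < y) G n + \sum_(n < z) G (y + n)%N.
    by move=> ->; rewrite big_split_ord.
  rewrite /wsum (split _ _ (fun n => f n * (F (iter (pn n) T x))%:C%C) N (esym (subnKC kN))).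
  apply: le_trans (cabsD _ _) _; rewrite lerD2l.
  apply: le_trans (cabs_sum _ _ _) _.
  have hle : (N - k ^ A <= k.+1 ^ A - k ^ A)%N by rewrite leq_sub2r// ltnW.
  have -> : S + (k.+1 ^ A - k ^ A)%:R * s =
      \sum_(n < k.+1 ^ A - k ^ A) (s + tail s (iter (pn (k ^ A + n)) T x)).
    by rewrite big_split/= addrC sumr_const card_ord mulr_natl.
  rewrite -(big_mkord xpredT (fun n => cabs (f (k ^ A + n)%N * (F (iter (pn (k ^ A + n)) T x))%:C%C))).
  rewrite -(big_mkord xpredT (fun n => s + tail s (iter (pn (k ^ A + n)) T x))).
  rewrite [leRHS](@big_cat_nat _ _ _ (N - k ^ A))//= -[leLHS]addr0; apply: lerD.
    by apply: ler_sum => n _; rewrite cabsM f1 mul1r cabsR; exact: le_tail.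
  by apply: sumr_ge0 => n _; rewrite addr_ge0 ?tail_ge0 ?ltW.
apply: le_trans (_ : (k ^ A)%:R^-1 * (wsum T f pn (k ^ A) F x +
    (S + (k.+1 ^ A - k ^ A)%:R * s)) <= _).
  by rewrite ler_wpM2l// invr_ge0 ltW.
rewrite addrA mulrDr lerD2l mulrA.
apply: le_trans (_ : 2 ^+ A * k%:R^-1 * s <= _).
  by rewrite ler_wpM2r ?(ltW s0)// gap_le.
by rewrite -ss invfM -!mulrA mulVf ?mulr1// gt_eqF.
Qed.

Lemma measurable_gapfun m : measurable_fun setT (gapfun m).
Proof.
apply: measurable_funM; first exact: measurable_cst.
apply: measurable_funD; first exact: (measurable_wsum_cabs mpT).
apply: measurable_sum => n.
exact: (measurableT_comp (measurable_tail _) (measurable_iter mpT _)).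
Qed.

Lemma gapfun_ge0 m x : 0 <= gapfun m x.
Proof.
rewrite mulr_ge0 ?invr_ge0// addr_ge0 ?wsum_ge0// sumr_ge0// => n _.
exact: tail_ge0.
Qed.

End RealPart.

Section Convergence.
Context d (X : measurableType d) (R : realType) (mu : probability X R) (T : X -> X).
Hypothesis mpT : measure_preserving mu T.

Lemma ae_wsum_cvg0 (f : nat -> R[i]) (pn : nat -> nat) (c C r : R) (F : X -> R) :
  unimodular f -> 0 < c -> 0 < C ->
  (forall (N : nat) al, (0 < N)%N ->
    cabs (\sum_(n < N) f n * ee (al * (pn n)%:R)) <= N%:R * (C * N%:R `^ (- c))) ->
  1 < r -> measurable_fun setT F ->
  (\int[mu]_x (`|F x| `^ r)%:E < +oo)%E ->
  {ae mu, forall x, (fun N => N%:R^-1 * wsum T f pn N F x) @ \oo --> (0 : R)}.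
Proof.
move=> f1 c0 C0 HW r1 mF Ffin.
have J0 : 0 <= fine (\int[mu]_x (`|F x| `^ r)%:E)%E.
  by apply: fine_ge0; apply: integral_ge0 => x _; rewrite lee_fin powR_ge0.
have FJ : (\int[mu]_x (`|F x| `^ r)%:E <= (fine (\int[mu]_x (`|F x| `^ r)%:E))%:E)%E.
  rewrite fineK// ge0_fin_numE//.
  by apply: integral_ge0 => x _; rewrite lee_fin powR_ge0.
have r10 : 0 < r - 1 by rewrite subr_gt0.
(* The truncation exponent [B] depends on [r] alone; [A] then has to be large enough for the power
   saving to beat the level [k ^ B]. *)
have [B hB] : exists B : nat, 2 <= B%:R * (r - 1).
  exists (Num.bound (2 / (r - 1))); rewrite -ler_pdivrMr// ltW//.
  by apply: archi_boundP; rewrite divr_ge0// ltW.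
have [A hA] : exists A : nat, B%:R + 2 <= c * A%:R.
  exists (Num.bound ((B%:R + 2) / c)); rewrite mulrC -ler_pdivrMr// ltW//.
  by apply: archi_boundP; rewrite divr_ge0 ?addr_ge0// ltW.
have A0 : (0 < A)%N.
  rewrite lt0n; apply/eqP => A0; move: hA; rewrite A0 mulr0.
  by have : 0 <= B%:R :> R by []; lra.
pose del := Num.min 1 ((r - 1) / 2).
have [del0 del1] : 0 < del <= 1 /\ del <= (r - 1) / 2.
  by rewrite /del lt_min ltr01 divr_gt0//= !ge_min !lexx orbT.
have K0 : 0 <= 3 * C + fine (\int[mu]_x (`|F x| `^ r)%:E)%E +
    2 ^+ A * fine (\int[mu]_x (`|F x| `^ r)%:E)%E.
  by rewrite !addr_ge0 ?mulr_ge0 ?exprn_ge0// ltW.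
have del0' : 0 < del by case/andP: del0.
have := @ae_cvg0 _ X R mu (gapfun T f pn F A) _ del del0' K0
  (measurable_gapfun mpT f pn mF A) (gapfun_ge0 T f pn F A)
  (fun m => integral_gapfun mpT f1 C0 HW r1 J0 mF FJ hA hB m del0 del1).
apply: filterS => x hx.
apply/cvgrPdist_lt => e e0.
have e20 : 0 < e / 2 by rewrite divr_gt0.
have [M0 _ hM0] : \forall m \near \oo, `|0 - gapfun T f pn F A m x| < e / 2.
  by move/cvgrPdist_lt: hx => /(_ _ e20).
(* The error [2 ^ A / sqrt (m + 1)] is at most [e / 2] as soon as [m + 1 >= y ^ 2]. *)
pose y := 2 ^+ A / (e / 2).
have y0 : 0 < y by rewrite divr_gt0// exprn_gt0.
pose M1 := Num.bound (y ^+ 2).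
have hM1 : y ^+ 2 < M1%:R by apply: archi_boundP; rewrite sqr_ge0.
pose M := maxn M0 M1.
exists (M.+1 ^ A)%N => // N /= hN.
have N0 : (0 < N)%N by rewrite (leq_trans _ hN)// expn_gt0.
(* The block containing [N] is found from the largest [k] with [k ^ A <= N]; [A > 0] bounds the
   search. *)
have exP : exists k, (k ^ A <= N)%N by exists M.+1.
have ubP k : (k ^ A <= N)%N -> (k <= N)%N.
  move=> h; apply: leq_trans h; case: k => // k.
  by rewrite -[X in (X <= _)%N]expn1 leq_pexp2l.
case: (ex_maxnP exP ubP) => k kN kmax.
have Mk : (M.+1 <= k)%N by exact: kmax.
case: k kN kmax Mk => // m kN kmax; rewrite ltnS => Mm.
have Nk : (N < m.+2 ^ A)%N.
  by rewrite ltnNge; apply/negP => /kmax; rewrite ltnn.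
rewrite sub0r normrN ger0_norm; last by rewrite mulr_ge0 ?invr_ge0 ?wsum_ge0.
have kNk : (m.+1 ^ A <= N < m.+2 ^ A)%N by rewrite kN.
have hg : N%:R^-1 * wsum T f pn N F x <= gapfun T f pn F A m x + 2 ^+ A * (m.+1%:R `^ 2^-1)^-1.
  exact: wsum_gap.
apply: (le_lt_trans hg).
have h1 : gapfun T f pn F A m x < e / 2.
  have := hM0 m (leq_trans (leq_maxl _ _) Mm).
  by rewrite /= sub0r normrN ger0_norm// gapfun_ge0.
have h2 : 2 ^+ A * (m.+1%:R `^ 2^-1)^-1 <= e / 2.
  rewrite ler_pdivrMr ?powR_gt0// mulrC -ler_pdivrMr// -/y.
  have -> : y = (y ^+ 2) `^ 2^-1 by rewrite powR12_sqrt ?sqr_ge0// sqrtr_sqr gtr0_norm.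
  rewrite ge0_ler_powR ?invr_ge0 ?nnegrE ?sqr_ge0// (le_trans (ltW hM1))// ler_nat.
  by rewrite (leq_trans (leq_maxr M0 _))// leqW.
by rewrite [e]splitr ltr_leD.
Qed.

End Convergence.

Theorem theoremC (R : realType) (q : nat) (f : nat -> R[i]) :
  (2 <= q)%N -> unimodular f -> q_multiplicative q f -> gelfond_type f ->
  forall (p : {poly R}) (pN : nat -> nat),
    (forall n : nat, p.[n%:R] = (pN n)%:R) ->
  forall (d : measure_display) (X : measurableType d)
         (mu : probability X R) (T : X -> X),
    measure_preserving mu T ->
  forall (r : R) (F : X -> R[i]), 1 < r -> in_Lr mu r F ->
    {ae mu, forall x : X,
       (fun N : nat =>
          cabs ((N%:R)^-1 * \sum_(n < N) f n * F (iter (pN n) T x)))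
       @ \oo --> 0}.
Proof.
move=> q1 f1 fM fG p pN pE d X mu T mpT r F r1 [mRe [mIm Ffin]].
have [c [C [c0 C0 hphase]]] := phase_bound q1 f1 fM fG (size p).
have HW (N : nat) al : (0 < N)%N ->
    cabs (\sum_(n < N) f n * ee (al * (pN n)%:R)) <= N%:R * (C * N%:R `^ (- c)).
  (* The polynomial [al *: p] has no larger degree than [p], so the constants do not depend on
     [al]. *)
  move=> N0; have := hphase N (al *: p) N0 (leqW (size_scale_leq _ _)).
  by under eq_bigr do rewrite hornerZ pE.
have r0 : 0 <= r by lra.
have mReF : measurable_fun setT (fun x => Re (F x)) by [].
have mImF : measurable_fun setT (fun x => Im (F x)) by [].
have mabs : measurable_fun setT (fun x => ((cabs (F x)) `^ r)%:E).
  apply/measurable_EFinP; apply: (measurableT_comp (@measurable_powR R r)).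
  have -> : (fun x => cabs (F x)) =
      (fun y => y `^ 2^-1) \o (fun x => Re (F x) ^+ 2 + Im (F x) ^+ 2).
    apply/funext => x /=; rewrite -cabs2E powR12_sqrt ?sqr_ge0//.
    by rewrite sqrtr_sqr ger0_norm ?cabs_ge0.
  apply: (measurableT_comp (@measurable_powR R 2^-1)).
  by apply: measurable_funD; exact: measurable_funX.
have fin (G : X -> R) : measurable_fun setT G -> (forall x, `|G x| <= cabs (F x)) ->
    (\int[mu]_x (`|G x| `^ r)%:E < +oo)%E.
  move=> mG GF; apply: le_lt_trans Ffin; apply: ge0_le_integral => //.
  - apply/measurable_EFinP; apply: (measurableT_comp (@measurable_powR R r)).
    exact: (measurableT_comp (@normr_measurable R setT) mG).
  - by move=> x _; rewrite lee_fin ge0_ler_powR ?nnegrE ?cabs_ge0.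
have ImF x : `|Im (F x)| <= cabs (F x).
  case: (F x) => a b /=; rewrite -sqrtr_sqr ler_sqrt ?addr_ge0 ?sqr_ge0//.
  by rewrite lerDr sqr_ge0.
have aeRe := ae_wsum_cvg0 mpT f1 c0 C0 HW r1 mReF (fin _ mReF (fun x => Re_le_cabs _)).
have aeIm := ae_wsum_cvg0 mpT f1 c0 C0 HW r1 mImF (fin _ mImF ImF).
move: aeRe aeIm; apply: filterS2 => x hRe hIm.
have hS := cvgD hRe hIm; rewrite addr0 in hS.
suff hN : \forall N \near \oo, 0 <= cabs (N%:R^-1 * \sum_(n < N) f n * F (iter (pN n) T x)) <=
    ((fun N => N%:R^-1 * wsum T f pN N (fun x => Re (F x)) x) +
     (fun N => N%:R^-1 * wsum T f pN N (fun x => Im (F x)) x)) N.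
  exact: (squeeze_cvgr hN (cvg_cst (0 : R)) (hS _)).
near=> N; rewrite /=; rewrite cabs_ge0/= cabsM cabsV cabs_nat -mulrDr ler_wpM2l ?invr_ge0//.
have -> : \sum_(n < N) f n * F (iter (pN n) T x) =
    \sum_(n < N) f n * (Re (F (iter (pN n) T x)))%:C%C +
    'i%C * \sum_(n < N) f n * (Im (F (iter (pN n) T x)))%:C%C.
  rewrite mulr_sumr -big_split/=; apply: eq_bigr => n _.
  by rewrite [F _ in LHS]complexE mulrDr [f n * ('i%C * _)]mulrCA.
apply: le_trans (cabsD _ _) _; rewrite lerD2l cabsM.
by rewrite {1}/cabs expr0n expr1n add0r sqrtr1 mul1r.
Unshelve. all: by end_near.
Qed.
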